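(* Let $p\ge 1$ be real and let $m\ge 1$ be an integer. Let $\mathrm{Shma}_{2^mD_p}$ denote the minimal area of hexagons which are circumscribed to the domain $2^mD_p$ and have three pairs of points on the boundary of $2^mD_p$. Then $$\mathrm{Shma}_{2^mD_p}=4\cdot\Delta(2^mD_p),$$ where $\Delta(2^mD_p)$ is the critical determinant of $2^mD_p$.
   Context: $D_p=\{(x,y)\in\mathbb{R}^2:|x|^p+|y|^p\le 1\}$ and $2^mD_p=\{2^mv:v\in D_p\}$. A lattice means a full-rank lattice in $\mathbb{R}^2$, and $d(\Lambda)$ denotes its determinant (covolume). For a centrally symmetric convex body $K\subset\mathbb{R}^2$, a lattice $\Lambda$ is $K$-admissible if the interior of $K$ contains no point of $\Lambda$ other than the origin. The critical determinant of $K$ is $\Delta(K)=\inf\{d(\Lambda):\Lambda\text{ is }K\text{-admissible}\}$. *)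

(* Defs.v *)
From HB Require Import structures.
From mathcomp Require Import all_boot all_order all_algebra.
From mathcomp Require Import all_classical all_reals all_analysis.
Set Implicit Arguments.
Unset Strict Implicit.
Unset Printing Implicit Defensive.
Import Order.TTheory GRing.Theory Num.Theory.
Import numFieldNormedType.Exports.
Local Open Scope classical_set_scope.
Local Open Scope ring_scope.

Section PlaneGeometry.
Variable R : realType.
Implicit Types (u v : R * R) (K L H : set (R * R)).

Definition lp_disc (p : R) : set (R * R) :=
  [set v | `|v.1| `^ p + `|v.2| `^ p <= 1].

Definition dilate (c : R) K : set (R * R) :=
  [set (c * v.1, c * v.2) | v in K].

Definition boundary K : set (R * R) := closure K `\` interior K.

Definition cross u v : R := u.1 * v.2 - u.2 * v.1.

Definition lattice_with_det L (d : R) : Prop :=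
  exists u v, [/\ cross u v != 0,
    L = [set x | exists a b : int, x = u *~ a + v *~ b] &
    d = `|cross u v|].

Definition admissible K L : Prop :=
  forall x, L x -> interior K x -> x = 0.

Definition critical_det K : R :=
  inf [set d | exists2 L, lattice_with_det L d & admissible K L].

(* Indices in 'I_6 are added modulo 6. *)

Definition side (h : 'I_6 -> R * R) (i : 'I_6) : set (R * R) :=
  [set ((1 - t) * (h i).1 + t * (h (i + 1)).1,
        (1 - t) * (h i).2 + t * (h (i + 1)).2) | t in `[0, 1]].

Definition hexagon_region (h : 'I_6 -> R * R) : set (R * R) :=
  [set x | exists w : 'I_6 -> R,
     [/\ forall i, 0 <= w i, \sum_i w i = 1 &
         x = (\sum_i w i * (h i).1, \sum_i w i * (h i).2)]].

(* The vertices are distinct and listed counterclockwise; an angle equal to pi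
   is allowed. This closes the class of hexagons, and is needed for a minimum
   to exist when the body is a parallelogram (as lp_disc 1 is). *)
Definition convex_hexagon (h : 'I_6 -> R * R) : Prop :=
  injective h /\ forall i j, 0 <= cross (h (i + 1) - h i) (h j - h i).

Definition circumscribed K (h : 'I_6 -> R * R) : Prop :=
  K `<=` hexagon_region h /\ forall i, side h i `&` K !=set0.

(* Six distinct contact points, one on each side, forming three pairs {P, -P}.
   If K is strictly convex, two sides on a common line would share
   their contact point, so all angles are then less than pi. *)
Definition three_contact_pairs K (h : 'I_6 -> R * R) : Prop :=
  exists P : 'I_6 -> R * R,
    [/\ injective P, forall i, (boundary K `&` side h i) (P i) &
        forall i, P (i + 3%:R) = - P i].

Definition hexagon_areas K : set R :=
  [set a | exists h, [/\ convex_hexagon h, circumscribed K h,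
     three_contact_pairs K h &
     (lebesgue_measure \x lebesgue_measure)%E (hexagon_region h) = a%:E]].

Definition Shma K : R := inf (hexagon_areas K).

End PlaneGeometry.

(* Main.v *)
Require Import Defs.
From HB Require Import structures.
From mathcomp Require Import all_boot all_order all_algebra.
From mathcomp Require Import all_classical all_reals all_analysis.
From mathcomp Require Import measurable_realfun ring lra zify.
Import Order.TTheory GRing.Theory Num.Theory.
Import numFieldNormedType.Exports.
Local Open Scope classical_set_scope.
Local Open Scope ring_scope.

(** Write K for the ball, N for its norm, so that K is the set where N <= 1, and
cross u v for the determinant of u and v.

A circumscribed hexagon gives a lattice. A convex hexagon with vertices A, B, C,
-A, -B, -C tiles the plane by translations, and half of the tiling lattice is
generated by midpoints of its sides. This lattice is admissible for the hexagon,
hence for K if the hexagon contains K, and its determinant is a quarter of the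
area (critical_det_le_hex, area_hex_strips). If p > 1, the unit circle is smooth
and strictly convex. A hexagon with three pairs of opposite contact points is
then bounded by the tangents at these points, so it is centrally symmetric and
its area is at least four times the critical determinant
(circumscribed_area_ge).

A lattice gives a hexagon. From an admissible lattice of determinant d one gets
unit vectors u and w such that w - u is a unit vector and 0 < cross u w <= d
(lattice_reduction). The tangents at u, w, w - u and the opposite points bound a
hexagon of the class. In terms of the three numbers by which the tangent forms
act on u and w, its area is an explicit rational function, which is 4 cross u w
minus a square over a positive number; so the area is at most 4 d
(dual_hexagon).

Choosing a pair (u, w) with the least positive cross product, which exists by
compactness (min_equilateral), gives a single hexagon of area at most 4 d for
all admissible lattices, that is, of area at most four times the critical
determinant. By the first part it is a hexagon of least area, and equality
holds (hexagon_areas_min).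

If p = 1 the ball is a square, and there are circumscribed hexagons that are not
symmetric. The square itself, with the midpoints of two opposite sides added as
vertices, is a hexagon of the class, and no other one has smaller area. That its
area is at most 4 d follows from lattice_reduction, because an equilateral pair
for this norm has a cross product of at least a quarter of the area of the
square (taxicab_equilateral). *)

Set Implicit Arguments.
Unset Strict Implicit.
Unset Printing Implicit Defensive.

(** * Cross products and centrally symmetric hexagons *)

Section SymmetricHexagons.
Variable R : realType.
Implicit Types (u v w x d A B C : R * R) (K : set (R * R)) (h : 'I_6 -> R * R).

Lemma crossC u v : cross u v = - cross v u.
Proof. by rewrite /cross; ring. Qed.

Lemma crossDl u v w : cross (u + v) w = cross u w + cross v w.
Proof. by rewrite /cross /=; ring. Qed.

Lemma crossNl u v : cross (- u) v = - cross u v.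
Proof. by rewrite /cross /=; ring. Qed.

Lemma crossDr u v w : cross u (v + w) = cross u v + cross u w.
Proof. by rewrite /cross /=; ring. Qed.

Lemma crossNr u v : cross u (- v) = - cross u v.
Proof. by rewrite /cross /=; ring. Qed.

Lemma cross_linl (s t : R) u v w :
  cross (s *: u + t *: v) w = s * cross u w + t * cross v w.
Proof. by rewrite /cross /= /GRing.scale /=; ring. Qed.

Lemma crossvv u : cross u u = 0.
Proof. by rewrite /cross; ring. Qed.

Lemma cross0r u : cross u 0 = 0.
Proof. by rewrite /cross /=; ring. Qed.

Lemma cross0l u : cross 0 u = 0.
Proof. by rewrite /cross /=; ring. Qed.

Lemma cross_lin2 (s t s' t' : R) u w :
  cross (s *: u + t *: w) (s' *: u + t' *: w) = (s * t' - t * s') * cross u w.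
Proof. by rewrite /cross /= /GRing.scale /=; ring. Qed.

Lemma linB (s t s' t' : R) u w :
  (s *: u + t *: w) - (s' *: u + t' *: w) = (s - s') *: u + (t - t') *: w.
Proof. by rewrite !scalerBl opprD addrACA. Qed.

Lemma linD (s t s' t' : R) u w :
  (s *: u + t *: w) + (s' *: u + t' *: w) = (s + s') *: u + (t + t') *: w.
Proof. by rewrite !scalerDl addrACA. Qed.

Lemma linZ (k s t : R) u w :
  k *: (s *: u + t *: w) = (k * s) *: u + (k * t) *: w.
Proof. by rewrite scalerDr !scalerA. Qed.

Lemma eq_lin (s t s' t' : R) u w : s = s' -> t = t' ->
  s *: u + t *: w = s' *: u + t' *: w.
Proof. by move=> -> ->. Qed.

Lemma cross_basis w u v : cross u v != 0 ->
  w = (cross w v / cross u v) *: u + (cross u w / cross u v) *: v.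
Proof.
by case: w => w1 w2; rewrite /cross /= => D0; congr pair => /=;
  rewrite /GRing.scale /=; field.
Qed.

Definition crossE := (crossDl, crossDr, crossNl, crossNr, crossvv).

Lemma ord6_ind (P : 'I_6 -> Prop) :
    P (inord 0) -> P (inord 1) -> P (inord 2) -> P (inord 3) ->
    P (inord 4) -> P (inord 5) ->
  forall i, P i.
Proof.
move=> P0 P1 P2 P3 P4 P5 i; rewrite -(inord_val i).
case: i => k k6; rewrite [nat_of_ord _]/=.
by move: k6; do 6?[case: k => [|k]] => k6 //=.
Qed.

Lemma inordD3 : (inord 0 + 3%:R = inord 3 :> 'I_6) *
  (inord 1 + 3%:R = inord 4 :> 'I_6) * (inord 2 + 3%:R = inord 5 :> 'I_6) *
  (inord 3 + 3%:R = inord 0 :> 'I_6) * (inord 4 + 3%:R = inord 1 :> 'I_6) *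
  (inord 5 + 3%:R = inord 2 :> 'I_6).
Proof. by do !split; apply/val_inj; rewrite /= !inordK. Qed.

Lemma inordS : (inord 0 + 1 = inord 1 :> 'I_6) *
  (inord 1 + 1 = inord 2 :> 'I_6) * (inord 2 + 1 = inord 3 :> 'I_6) *
  (inord 3 + 1 = inord 4 :> 'I_6) * (inord 4 + 1 = inord 5 :> 'I_6) *
  (inord 5 + 1 = inord 0 :> 'I_6).
Proof. by do !split; apply/val_inj; rewrite /= !inordK. Qed.

Definition hex A B C : 'I_6 -> R * R :=
  fun i => nth 0 [:: A; B; C; - A; - B; - C] i.

Lemma hexE A B C : (hex A B C (inord 0) = A) * (hex A B C (inord 1) = B) *
  (hex A B C (inord 2) = C) * (hex A B C (inord 3) = - A) *
  (hex A B C (inord 4) = - B) * (hex A B C (inord 5) = - C).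
Proof. by rewrite /hex !inordK. Qed.

Lemma sum6 (V : nmodType) (F : 'I_6 -> V) :
  \sum_i F i = F (inord 0) + F (inord 1) + F (inord 2) + F (inord 3)
    + F (inord 4) + F (inord 5).
Proof.
rewrite !big_ord_recl big_ord0 addr0 !addrA.
by do !congr (_ + _); congr F; apply/val_inj; rewrite /= inordK.
Qed.

Lemma convex_hexagon_region h x : convex_hexagon h -> hexagon_region h x ->
  forall i, 0 <= cross (h (i + 1) - h i) (x - h i).
Proof.
move=> [_ hC] [w [w0 w1 ->]] i; set d := h (i + 1) - h i.
rewrite [leRHS](_ : _ = \sum_j w j * cross d (h j - h i)).
  by apply: sumr_ge0 => j _; exact: mulr_ge0 (w0 j) (hC i j).
have ->: \sum_j w j * cross d (h j - h i) = \sum_j (d.1 * (w j * (h j).2) -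
    d.2 * (w j * (h j).1) - w j * cross d (h i)).
  by apply: eq_bigr => j _; rewrite /cross /=; ring.
by rewrite !sumrB -!mulr_sumr -mulr_suml w1 /cross /=; ring.
Qed.

(** The cross products are twice the areas of the triangles spanned by the origin
and a pair of vertices. The first three inequalities make the six vertices run
counterclockwise around the origin; each of the last three says that the
boundary does not turn right at the vertex in its name, and at the opposite
one. *)
Record proper_hex A B C : Prop := ProperHex {
  proper_AB : 0 < cross A B;
  proper_BC : 0 < cross B C;
  proper_AC : 0 < cross A C;
  proper_turnC : cross A B <= cross B C + cross A C;
  proper_turnB : cross A C <= cross A B + cross B C;
  proper_turnA : cross B C <= cross A B + cross A C }.

Definition hex_strips A B C : set (R * R) :=
  [set x | [/\ `|cross x (B - A)| <= cross A B,
    `|cross x (C - B)| <= cross B C & `|cross x (A + C)| <= cross A C]].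

Lemma proper_hex_sub u w : 0 < cross u w -> proper_hex u w (w - u).
Proof. by have := crossC w u; split; rewrite ?crossE; lra. Qed.

Lemma hex_inj A B C : proper_hex A B C -> injective (hex A B C).
Proof.
case=> ab bc ac _ _ _.
have ba := crossC B A; have cb := crossC C B; have ca := crossC C A.
apply: ord6_ind; apply: ord6_ind; rewrite !hexE // => e; exfalso;
  have := congr1 (fun z => cross z A) e; have := congr1 (fun z => cross z B) e;
  have := congr1 (fun z => cross z C) e; rewrite !crossE; lra.
Qed.

Lemma hex_convex A B C : proper_hex A B C -> convex_hexagon (hex A B C).
Proof.
move=> pABC; split; first exact: hex_inj.
have [ab bc ac tC tB tA] := pABC.
have ba := crossC B A; have cb := crossC C B; have ca := crossC C A.
by apply: ord6_ind; apply: ord6_ind; rewrite !inordS !hexE !crossE; lra.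
Qed.

(** The half-planes of opposite sides form a strip. Conversely, the origin sees
every point of the three strips through one of the sides, so the point is a
combination of the two ends of that side of total weight at most 1; the missing
weight is shared by the opposite vertices A and -A. *)
Lemma hexagon_region_hex A B C : proper_hex A B C ->
  hexagon_region (hex A B C) = hex_strips A B C.
Proof.
move=> pABC; have cABC := hex_convex pABC.
have [ab bc ac tC tB tA] := pABC.
have ba := crossC B A; have cb := crossC C B; have ca := crossC C A.
apply/seteqP; split=> x.
  move=> /(convex_hexagon_region cABC) ge0.
  have := ge0 (inord 0); have := ge0 (inord 1); have := ge0 (inord 2).
  have := ge0 (inord 3); have := ge0 (inord 4); have := ge0 (inord 5).
  rewrite !inordS !hexE !crossE.
  have := (crossC A x, crossC B x, crossC C x) => -[[-> ->] ->].
  by move=> *; split; rewrite ler_norml !crossE; lra.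
have cone P Q w : 0 < cross P Q -> 0 <= cross P w -> 0 <= cross w Q ->
    cross P w + cross w Q <= cross P Q ->
    exists s t, [/\ 0 <= s, 0 <= t, s + t <= 1 & w = s *: P + t *: Q].
  move=> pq pw wq le1; exists (cross w Q / cross P Q), (cross P w / cross P Q).
  rewrite !divr_ge0 ?(ltW pq)// -mulrDl ler_pdivrMr// mul1r addrC; split=> //.
  have pq0 : cross P Q != 0 by rewrite gt_eqF.
  by move: pq0; rewrite /cross; case: w {pw wq le1} => w1 w2 /= ?; congr pair => /=;
    rewrite /GRing.scale /=; field.
have upper w : hex_strips A B C w -> 0 <= cross A w ->
    exists a b c, `|a| + `|b| + `|c| <= 1 /\ w = a *: A + b *: B + c *: C.
  rewrite /hex_strips /= !ler_norml !crossE => -[s1 s2 s3] Aw.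
  have := (crossC w A, crossC w B, crossC w C) => -[[eA eB] eC].
  have [Bw|Bw] := leP (cross B w) 0.
    have [||||s [t [s0 t0 st e]]] := cone A B w => //; try lra.
    by exists s, t, 0; rewrite !ger0_norm// scale0r !addr0.
  have [Cw|Cw] := leP (cross C w) 0.
    have [||||s [t [s0 t0 st e]]] := cone B C w => //; try lra.
    by exists 0, s, t; rewrite !ger0_norm// scale0r !add0r.
  have [||||s [t [s0 t0 st e]]] := cone C (- A) w => //; rewrite ?crossE; try lra.
  exists (- t), 0, s; rewrite normrN !ger0_norm// scale0r !addr0.
  by rewrite [t + s]addrC e scalerN scaleNr [_ *: C + _]addrC.
have hull a b c : `|a| + `|b| + `|c| <= 1 ->
    hexagon_region (hex A B C) (a *: A + b *: B + c *: C).
  move=> le1; pose r := 1 - (`|a| + `|b| + `|c|).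
  exists (fun i => nth 0 [:: (`|a| + a + r) / 2; (`|b| + b) / 2;
    (`|c| + c) / 2; (`|a| - a + r) / 2; (`|b| - b) / 2; (`|c| - c) / 2] i).
  have aa := ler_norm a; have bb := ler_norm b; have cc := ler_norm c.
  have := ler_norm (- a); have := ler_norm (- b); have := ler_norm (- c).
  rewrite !normrN /r => c' b' a'; split.
  - by apply: ord6_ind; rewrite /= inordK//=; lra.
  - by rewrite sum6 !inordK//= /r; field.
  - rewrite !sum6 !hexE !inordK//= /GRing.scale /=.
    by congr pair => /=; rewrite /GRing.scale /=; field.
move=> xS; have [/(upper _ xS)[a [b [c [le1 ->]]]]|Ax] := leP 0 (cross A x).
  exact: hull.
have [||a [b [c [le1 /(congr1 -%R)]]]] := upper (- x).
- by move: xS; rewrite /hex_strips /= !crossNl !normrN.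
- by rewrite crossE; lra.
rewrite opprK !opprD -!scaleNr => ->; apply: hull.
by rewrite !normrN.
Qed.

End SymmetricHexagons.

(** * An admissible lattice from a symmetric hexagon *)

Section Interior.
Variable R : realType.
Implicit Types (u v w x d A B C : R * R) (K : set (R * R)) (h : 'I_6 -> R * R).

Lemma interior_segment K x v : interior K x ->
  exists2 e : R, 0 < e & forall t, `|t| < e -> K (x + t *: v).
Proof.
move=> Kx; have : (fun t : R => x + t *: v) t @[t --> (0 : R)] --> x + 0 *: v.
  by apply: cvgD; [exact: cvg_cst|apply: cvgZr_tmp; exact: cvg_id].
rewrite scale0r addr0 => /(_ K Kx) /nbhs_ballP[e /= e0 eK].
by exists e => // t te; apply: eK; rewrite /ball /= sub0r normrN.
Qed.

(** A nonzero linear form has no local maximum: it increases along its own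
direction, here (d.2, - d.1). *)
Lemma interior_cross_lt K d (c : R) x : d != 0 ->
  (forall y, K y -> cross y d <= c) -> interior K x -> cross x d < c.
Proof.
move=> d0 Kc /(interior_segment (d.2, - d.1))[e e0 /(_ (e / 2))].
have e2 : `|e / 2| < e by rewrite gtr0_norm; lra.
move=> /(_ e2)/Kc; apply: lt_le_trans.
rewrite crossDl ltrDl /cross /= /GRing.scale /=.
have : 0 < d.2 ^+ 2 + d.1 ^+ 2.
  rewrite lt_neqAle addr_ge0 ?sqr_ge0// andbT eq_sym.
  apply: contra d0; rewrite paddr_eq0 ?sqr_ge0// !sqrf_eq0 => /andP[/eqP d2 /eqP d1].
  by apply/eqP; case: d d1 d2 {Kc} => ? ? /= -> ->.
by move=> d0'; have := mulr_gt0 e0 d0'; rewrite !expr2; lra.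
Qed.

Lemma interior_cross_norm_lt K d (c : R) x : d != 0 ->
  (forall y, K y -> `|cross y d| <= c) -> interior K x -> `|cross x d| < c.
Proof.
move=> d0 Kc Kx; rewrite ltr_norml; apply/andP; split.
  rewrite ltrNl -crossNr; apply: interior_cross_lt Kx; rewrite ?oppr_eq0// => y.
  by move=> /Kc; rewrite ler_norml crossNr; lra.
by apply: interior_cross_lt Kx => // y /Kc; rewrite ler_norml => /andP[].
Qed.

(** The midpoints u and w of two adjacent sides generate a lattice whose
determinant is a quarter of the sum of cross products, which is the area of the
hexagon; doubled, this is the lattice by which copies of the hexagon tile the
plane. It is admissible: write the cross products as X + Z, Y + Z and X + Y with
X, Y, Z nonnegative. The forms of the three strips, which have these sums as
bounds, take the values (a + b) X + a Z, (a + b) Y + b Z and a Y - b X at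
a u + b w. *)
Lemma critical_det_le_hex A B C K : proper_hex A B C ->
    K `<=` hexagon_region (hex A B C) ->
  4 * critical_det K <= cross A B + cross B C + cross A C.
Proof.
move=> pABC; rewrite hexagon_region_hex// => KS.
have [ab bc ac tC tB tA] := pABC.
have ba := crossC B A; have cb := crossC C B; have ca := crossC C A.
rewrite -ler_pdivlMl//.
apply: ge_inf; first by exists 0 => d [L [u [v [_ _ ->]] _]]; exact: normr_ge0.
pose u := 2^-1 *: (A + B); pose w := 2^-1 *: (B + C).
have uw : cross u w = 4^-1 * (cross A B + cross B C + cross A C).
  by rewrite /cross /u /w /= /GRing.scale /=; field.
exists [set x | exists a b : int, x = u *~ a + w *~ b].
  exists u, w; split=> //; rewrite uw; first by rewrite gt_eqF//; lra.
  by rewrite gtr0_norm//; lra.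
move=> _ [a [b ->]] Kx.
have D1 : B - A != 0.
  by apply: contraTneq ab => /subr0_eq ->; rewrite crossvv ltxx.
have D2 : C - B != 0.
  by apply: contraTneq bc => /subr0_eq ->; rewrite crossvv ltxx.
have D3 : A + C != 0.
  by apply: contraTneq ac => /addr0_eq <-; rewrite !crossE oppr0 ltxx.
have := interior_cross_norm_lt D1 (fun y Ky => let: And3 p _ _ := KS y Ky in p) Kx.
have := interior_cross_norm_lt D2 (fun y Ky => let: And3 _ p _ := KS y Ky in p) Kx.
have := interior_cross_norm_lt D3 (fun y Ky => let: And3 _ _ p := KS y Ky in p) Kx.
pose X := (cross A B + cross A C - cross B C) / 2.
pose Y := (cross B C + cross A C - cross A B) / 2.
pose Z := (cross A B + cross B C - cross A C) / 2.
have X0 : 0 <= X by rewrite /X; lra.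
have Y0 : 0 <= Y by rewrite /Y; lra.
have Z0 : 0 <= Z by rewrite /Z; lra.
have -> : cross A B = X + Z by rewrite /X /Z; lra.
have -> : cross B C = Y + Z by rewrite /Y /Z; lra.
have -> : cross A C = X + Y by rewrite /X /Y; lra.
have -> : u *~ a + w *~ b = a%:~R *: u + b%:~R *: w by rewrite !scaler_int.
rewrite !cross_linl.
have mid P Q D : cross (2^-1 *: (P + Q)) D = (cross P D + cross Q D) / 2.
  by rewrite /cross /= /GRing.scale /=; field.
have -> : cross u (A + C) = Y by rewrite /u mid !crossE ba /Y; lra.
have -> : cross w (A + C) = - X by rewrite /w mid !crossE ba ca /X; lra.
have -> : cross u (C - B) = Y by rewrite /u mid !crossE /Y; lra.
have -> : cross w (C - B) = Y + Z by rewrite /w mid !crossE cb /Y /Z; lra.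
have -> : cross u (B - A) = X + Z by rewrite /u mid !crossE ba /X /Z; lra.
have -> : cross w (B - A) = X by rewrite /w mid !crossE ba cb ca /X; lra.
rewrite !ltr_norml => /andP[f3l f3r] /andP[f2l f2r] /andP[f1l f1r].
have ge1 (n : int) : 0 < n -> 1 <= n%:~R :> R by rewrite ler1z gtz0_ge1.
have le1 (n : int) : n < 0 -> n%:~R <= -1 :> R.
  by move=> n0; rewrite lerNr -mulrNz; apply: ge1; rewrite oppr_gt0.
have ge0 (n : int) : 0 <= n -> 0 <= n%:~R :> R by rewrite ler0z.
have le0 (n : int) : n <= 0 -> n%:~R <= 0 :> R by rewrite lerz0.
have pX k : 0 <= k -> 0 <= k * X by move=> k0; exact: mulr_ge0.
have pY k : 0 <= k -> 0 <= k * Y by move=> k0; exact: mulr_ge0.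
have pZ k : 0 <= k -> 0 <= k * Z by move=> k0; exact: mulr_ge0.
clearbody X Y Z u w; clear -f1l f1r f2l f2r f3l f3r ge1 le1 ge0 le0 pX pY pZ.
(* If a and b have the same sign, a form of the first two strips is too large;
   if they have opposite signs, the third one is. *)
case: (ltgtP a 0) => [/le1 a1|/ge1 a1|a0].
- have [/ge1 b1|/le0 b0] := ltP 0 b.
    have := pX (b%:~R - 1); have := pY (- a%:~R - 1).
    by move=> /(_ ltac:(lra)) hY /(_ ltac:(lra)) hX; exfalso; lra.
  have := pX (- a%:~R - b%:~R - 1); have := pZ (- a%:~R - 1).
  by move=> /(_ ltac:(lra)) hZ /(_ ltac:(lra)) hX; exfalso; lra.
- have [/le1 b1|/ge0 b0] := ltP b 0.
    have := pX (- b%:~R - 1); have := pY (a%:~R - 1).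
    by move=> /(_ ltac:(lra)) hY /(_ ltac:(lra)) hX; exfalso; lra.
  have := pX (a%:~R + b%:~R - 1); have := pZ (a%:~R - 1).
  by move=> /(_ ltac:(lra)) hZ /(_ ltac:(lra)) hX; exfalso; lra.
- have a0R : a%:~R = 0 :> R by rewrite a0.
  rewrite a0R !mul0r in f2l f2r.
  case: (ltgtP b 0) => [/le1 b1|/ge1 b1|->].
  + have := pY (- b%:~R - 1); have := pZ (- b%:~R - 1).
    by move=> /(_ ltac:(lra)) hZ /(_ ltac:(lra)) hY; exfalso; lra.
  + have := pY (b%:~R - 1); have := pZ (b%:~R - 1).
    by move=> /(_ ltac:(lra)) hZ /(_ ltac:(lra)) hY; exfalso; lra.
  + by rewrite a0R mulr0z !scale0r addr0.
Qed.

End Interior.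

(** * The area of a symmetric hexagon *)

Section HexagonArea.
Variable R : realType.
Implicit Types (u v w A B C : R * R) (K : set (R * R)) (h : 'I_6 -> R * R).

Local Notation mu := (@lebesgue_measure R).
Local Notation area := (lebesgue_measure \x lebesgue_measure)%E.
Local Notation RxR := (measurableTypeR R * measurableTypeR R)%type.

Lemma lebesgue_measure_translate (c : R) (X : set (measurableTypeR R)) : measurable X ->
  mu ((fun y => y + c) @^-1` X) = mu X.
Proof.
move=> mX; apply/esym.
have mf : measurable_fun setT (fun y : measurableTypeR R => y + c : measurableTypeR R).
  by apply: measurable_funD => //; exact: measurable_cst.
pose mfm := isMeasurableFun.Build _ _ _ _ _ mf.
pose f : {mfun measurableTypeR R >-> measurableTypeR R} :=
  HB.pack (fun y : measurableTypeR R => y + c : measurableTypeR R) mfm.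
apply: (@lebesgue_measure_unique R (pushforward mu f)) => //= _ [[a b]] _ <-.
rewrite /pushforward.
have -> : f @^-1` `]a, b]%classic = `]a - c, b - c]%classic.
  by apply/seteqP; split=> y /=; rewrite !in_itv /= ltrBlDr lerBrDr.
rewrite /= !lebesgue_measure_itv /= !lte_fin ltrD2r.
by case: ifP => // _; rewrite -!EFinB opprB addrA subrK.
Qed.

Lemma measurable_affine (a b c : R) :
  measurable_fun setT (fun v : RxR => a * v.1 + b * v.2 + c).
Proof.
by do 2!apply: measurable_funD => //; exact: measurable_funM.
Qed.

Definition linmap (a b c d : R) (v : R * R) : R * R :=
  (a * v.1 + b * v.2, c * v.1 + d * v.2).

Lemma measurable_linmap a b c d : measurable_fun setT (linmap a b c d : RxR -> RxR).
Proof.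
apply/measurable_fun_pairP; split.
  by have := measurable_affine a b 0; under eq_fun do rewrite addr0.
by have := measurable_affine c d 0; under eq_fun do rewrite addr0.
Qed.

Lemma measurable_linmap_preimage a b c d (S : set RxR) : measurable S ->
  measurable (linmap a b c d @^-1` S : set RxR).
Proof.
move=> mS; rewrite -[X in measurable X]setTI; exact: measurable_linmap.
Qed.

(** A vertical shear translates each vertical section. *)
Lemma area_vshear k (S : set RxR) : measurable S ->
  area (linmap 1 0 k 1 @^-1` S : set RxR) = area S.
Proof.
move=> mS; apply: eq_integral => x _ /=.
rewrite -[RHS](lebesgue_measure_translate (k * x)); last exact: measurable_xsection.
congr (mu _); apply/seteqP; split=> y; rewrite /xsection /= !inE /linmap /=.
  by rewrite mul1r mul0r addr0 mul1r addrC.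
by rewrite mul1r mul0r addr0 mul1r addrC.
Qed.

Lemma area_swap (S : set RxR) : measurable S ->
  area S = (\int[mu]_y mu (ysection S y))%E.
Proof.
move=> mS; apply: (product_measure_unique (m1 := mu) (m2 := mu)
  (m' := (mu \x^ mu)%E)) => // X Y mX mY.
exact: product_measure2E.
Qed.

Lemma area_hshear k (S : set RxR) : measurable S ->
  area (linmap 1 k 0 1 @^-1` S : set RxR) = area S.
Proof.
move=> mS; rewrite !area_swap//; last exact: measurable_linmap_preimage.
apply: eq_integral => y _ /=.
rewrite -[RHS](lebesgue_measure_translate (k * y)); last exact: measurable_ysection.
congr (mu _); apply/seteqP; split=> x; rewrite /ysection /= !inE /linmap /=.
  by rewrite mul1r mul0r add0r mul1r.
by rewrite mul1r mul0r add0r mul1r.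
Qed.

Lemma linmap_comp_preimage a b c d a' b' c' d' (S : set (R * R)) :
  linmap a b c d @^-1` (linmap a' b' c' d' @^-1` S) =
  linmap (a' * a + b' * c) (a' * b + b' * d) (c' * a + d' * c) (c' * b + d' * d)
    @^-1` S.
Proof.
by apply/seteqP; split=> v /=; rewrite /linmap /= => H; [move: H|move: H];
  match goal with |- S ?x -> S ?y => have -> : x = y by congr pair; ring end.
Qed.

Lemma eq_area_linmap a b c d a' b' c' d' (S : set RxR) :
  a = a' -> b = b' -> c = c' -> d = d' ->
  area (linmap a b c d @^-1` S : set RxR) = area (linmap a' b' c' d' @^-1` S : set RxR).
Proof. by move=> -> -> -> ->. Qed.

(** Every matrix of determinant 1 is a product of shears. *)
Lemma area_SL2 a b c d (S : set RxR) : a * d - b * c = 1 -> measurable S ->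
  area (linmap a b c d @^-1` S : set RxR) = area S.
Proof.
move=> det; wlog c0 : a b c d S det / c != 0 => [th mS|mS].
  (* A vertical shear makes the lower left entry nonzero. *)
  have [c0|] := eqVneq c 0; last by move/th; exact.
  have a0 : a != 0 by apply: contra_eq_neq det => ->; rewrite c0; lra.
  rewrite -(area_vshear (-1) mS) -[in RHS](th a b a (b + d)) //.
  - rewrite linmap_comp_preimage; apply: eq_area_linmap; rewrite ?c0; ring.
  - by move: det; rewrite c0; lra.
  - exact: measurable_linmap_preimage.
rewrite -(area_hshear ((a - 1) / c) mS).
have mS1 := measurable_linmap_preimage 1 ((a - 1) / c) 0 1 mS.
rewrite -(area_vshear c mS1).
have mS2 := measurable_linmap_preimage 1 0 c 1 mS1.
rewrite -[RHS](area_hshear ((d - 1) / c) mS2).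
rewrite !linmap_comp_preimage; apply: eq_area_linmap; try by field.
have -> : b = (a * d - 1) / c by rewrite -det; field.
by field.
Qed.

Lemma integral_affine (p q a b : R) : a < b ->
  (\int[mu]_(x in `[a, b]) (p + q * x)%:E =
    ((b - a) * (p + q * (a + b) / 2))%:E)%E.
Proof.
move=> ab; pose F x : R := p * x + q / 2 * x ^+ 2.
have dF (x : R) : is_derive x 1 F (p + q * x).
  by rewrite /F; apply: is_derive_eq; rewrite /GRing.scale /=; field.
have cF (x : R) : {for x, continuous F}.
  by apply: differentiable_continuous; apply/derivable1_diffP; case: (dF x).
rewrite (@continuous_FTC2 _ _ F)//.
- by rewrite /F -EFinB; congr EFin; field.
- apply: continuous_subspaceT => x; apply: cvgD; first exact: cvg_cst.
  by apply: cvgM; [exact: cvg_cst|exact: cvg_id].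
- split; first by move=> x _; case: (dF x).
  + exact: cvg_at_right_filter (cF a).
  + exact: cvg_at_left_filter (cF b).
- by move=> x _; rewrite derive1E; case: (dF x).
Qed.

Lemma integral_two_affine (f : R -> R) (p1 q1 p2 q2 a b c : R) : a < b -> b < c ->
    measurable_fun setT f ->
    {in `[a, b], forall x, f x = p1 + q1 * x} ->
    {in `[b, c], forall x, f x = p2 + q2 * x} ->
  (\int[mu]_(x in `[a, c]) (f x)%:E =
    ((b - a) * (p1 + q1 * (a + b) / 2) + (c - b) * (p2 + q2 * (b + c) / 2))%:E)%E.
Proof.
move=> ab bc mf f1 f2.
have mF D : measurable_fun D (fun x => (f x)%:E).
  by apply/measurable_EFinP; apply: measurable_funS mf.
rewrite (@itv_bndbnd_setU _ _ _ (BRight b)) ?bnd_simp ?ltW//.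
rewrite integral_setU//; [|exact: mF|]; last first.
  by apply/disj_setPS => x /= []; rewrite !in_itv /= => /andP[_ +] /andP[+ _]; lra.
rewrite integral_itv_obnd_cbnd; last exact: mF.
rewrite EFinD; congr (_ + _)%E.
  by rewrite -integral_affine//; apply: eq_integral => x; rewrite inE => /f1 ->.
by rewrite -integral_affine//; apply: eq_integral => x; rewrite inE => /f2 ->.
Qed.

Lemma measurable_strip (a b c : R) :
  measurable ([set v | `|a * v.1 + b * v.2| <= c] : set RxR).
Proof.
have := measurable_affine a b 0; under eq_fun do rewrite addr0.
move=> /(_ measurableT `[- c, c]%classic (measurable_itv _)); rewrite setTI.
by congr measurable; apply/seteqP; split=> v /=; rewrite in_itv /= ler_norml.
Qed.

(** If p + q = 2 and ga p = ga - be + al, these are the strips of the hexagon with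
vertices A = (1, 0), B = (1 - p, al), C = (-1, ga), and its cross products are al,
be, ga. Two of its sides are vertical, so between them only the other two strips
bound the vertical sections. *)
Definition normal_strips (al be ga p q : R) : set (R * R) :=
  [set v | [/\ `|al * v.1 + p * v.2| <= al,
    `|(ga - al) * v.1 + q * v.2| <= be & `|v.1| <= 1]].

(** The upper boundary of the normal form over the abscissa x; by central
symmetry the lower boundary is - normal_top (- x). *)
Definition normal_top (al be ga p q x : R) : R :=
  Num.min (al * (1 - x) / p) ((be - (ga - al) * x) / q).

Lemma measurable_normal_strips al be ga p q :
  measurable (normal_strips al be ga p q : set RxR).
Proof.
rewrite (_ : normal_strips al be ga p q =
    [set v | `|al * v.1 + p * v.2| <= al] `&`
    [set v | `|(ga - al) * v.1 + q * v.2| <= be] `&`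
    [set v | `|1 * v.1 + 0 * v.2| <= 1]).
  by apply: measurableI; [apply: measurableI|]; exact: measurable_strip.
by apply/seteqP; split=> v /=; rewrite /normal_strips /= mul1r mul0r addr0;
  [case|case=> -[]].
Qed.

Section NormalForm.
Variables (al be ga p q : R).
Hypotheses (p0 : 0 < p) (q0 : 0 < q).

Local Notation U := (normal_top al be ga p q).
Local Notation T := (normal_strips al be ga p q : set RxR).

Lemma normal_top_le x y : (y <= U x) = (al * x + p * y <= al) &&
  ((ga - al) * x + q * y <= be).
Proof.
by rewrite /U le_min !ler_pdivlMr//; congr (_ && _); apply/idP/idP; lra.
Qed.

Lemma xsection_normal_strips x : `|x| <= 1 ->
  xsection T x = `[- U (- x), U x]%classic.
Proof.
move=> x1; apply/seteqP; split=> y; rewrite /xsection /= in_itv /= inE.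
  rewrite lerNl !normal_top_le /normal_strips /= !ler_norml.
  by move=> [/andP[? ?] /andP[? ?] _]; apply/andP; split; apply/andP; split; lra.
rewrite lerNl !normal_top_le /normal_strips /= !ler_norml.
move=> /andP[/andP[? ?] /andP[? ?]].
by move: x1; rewrite ler_norml => ?; split => //; apply/andP; split; lra.
Qed.

Lemma xsection_normal_strips0 x : 1 < `|x| -> xsection T x = set0.
Proof.
move=> x1; apply/seteqP; split=> // y; rewrite /xsection /= inE => -[_ _ /=].
by rewrite leNgt x1.
Qed.

Lemma measurable_normal_top : measurable_fun setT U.
Proof.
apply: measurable_minr; apply: measurable_funM => //; last first.
  by apply: measurable_funB => //; apply: measurable_funM.
by apply: measurable_funM => //; apply: measurable_funB.
Qed.

Lemma area_normal_strips : 0 < al -> 0 < ga -> al <= be + ga ->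
    ga <= al + be -> p + q = 2 -> ga * p = ga - be + al ->
  area T = (al + be + ga)%:E.
Proof.
move=> al0 ga0 tal tga pq pE.
(* The abscissa of the vertex B, where the two branches of the upper boundary
   meet. *)
pose b := 1 - p.
have U0 x : `|x| <= 1 -> 0 <= U x.
  rewrite ler_norml => /andP[xl xr].
  rewrite /normal_top le_min !divr_ge0 ?(ltW p0) ?(ltW q0)//; first by nra.
  have : 0 <= be by lra.
  by nra.
pose W (x : R) := U x + U (- x).
pose I : set R := `[-1, 1]%classic.
transitivity (\int[mu]_x (((fun x => (W x)%:E) \_ I) x))%E.
  apply: eq_integral => x _; rewrite patchE; case: ifPn.
    rewrite inE /I /= in_itv /= -ler_norml => x1.
    rewrite xsection_normal_strips// lebesgue_measure_itv /= lte_fin.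
    have UNx := U0 (- x); rewrite normrN in UNx.
    have {UNx}UNx := UNx x1; have Ux := U0 _ x1.
    case: ifPn => [_|]; first by rewrite -EFinB opprK.
    by rewrite -leNgt => le; congr EFin; rewrite /W; lra.
  rewrite notin_setE /I /= in_itv /= => /negP; rewrite -ler_norml -ltNge => x1.
  by rewrite xsection_normal_strips0// measure0.
rewrite -integral_mkcond.
have mU := measurable_normal_top.
have mUN : measurable_fun setT (fun x : R => U (- x)).
  by apply: (measurableT_comp mU); exact: oppr_measurable.
have p2 : p < 2 by rewrite -pq ltrDl.
have pn0 : p != 0 by rewrite gt_eqF.
have qn0 : q != 0 by rewrite gt_eqF.
have qE : q = 2 - p by rewrite -pq addrC addKr.
have beE : be = ga + al - ga * p by rewrite pE; ring.
have k0 : 0 <= 2 * al - ga * p by rewrite pE; lra.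
have U1 (x : R) : b <= x -> U x = al / p - al / p * x.
  move=> bx; rewrite /normal_top min_l; first by field.
  rewrite ler_pdivlMr// mulrAC ler_pdivrMr// -subr_ge0.
  rewrite [leRHS](_ : _ = (x - b) * (2 * al - ga * p)); last first.
    by rewrite /b beE qE; ring.
  by rewrite mulr_ge0// subr_ge0.
have U2 (x : R) : x <= b -> U x = be / q - (ga - al) / q * x.
  move=> bx; rewrite /normal_top min_r; first by field.
  rewrite ler_pdivlMr// mulrAC ler_pdivrMr// -subr_ge0.
  rewrite [leRHS](_ : _ = (b - x) * (2 * al - ga * p)); last first.
    by rewrite /b beE qE; ring.
  by rewrite mulr_ge0// subr_ge0.
rewrite -[LHS]/(\int[mu]_(x in I) ((U x)%:E + (U (- x)%R)%:E))%E.
have in1 (x : R) : I x -> `|x| <= 1 by rewrite /I /= in_itv /= ler_norml.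
rewrite ge0_integralD//=; last 4 first.
- by move=> x /in1 x1; rewrite lee_fin U0.
- by apply/measurable_EFinP; apply: measurable_funS mU.
- by move=> x /in1 x1; rewrite lee_fin U0 ?normrN.
- by apply/measurable_EFinP; apply: measurable_funS mUN.
rewrite (@integral_two_affine U (be / q) (- ((ga - al) / q)) (al / p) (- (al / p)) _ b)//.
rewrite (@integral_two_affine (fun x => U (- x)) (al / p) (al / p) (be / q)
  ((ga - al) / q) _ (- b))//.
- rewrite -EFinD; congr EFin; rewrite /b beE; move: qn0; rewrite qE => qn0.
  by field; apply/andP.
- by move: p0 q0; rewrite /b; lra.
- by move: p0 q0; rewrite /b; lra.
- by move=> x; rewrite in_itv /= => /andP[_ xb]; rewrite U1 ?mulrN ?opprK// lerNr.
- by move=> x; rewrite in_itv /= => /andP[bx _]; rewrite U2 ?mulrN ?opprK// lerNl.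
- by move: p0 q0; rewrite /b; lra.
- by move: p0 q0; rewrite /b; lra.
- by move=> x; rewrite in_itv /= => /andP[_ xb]; rewrite U2// mulNr.
- by move=> x; rewrite in_itv /= => /andP[bx _]; rewrite U1// mulNr.
- exact: measurable_itv.
Qed.
End NormalForm.

(** The linear map of determinant 1 that sends A to (1, 0) and C to
(-1, cross A C) preserves areas and cross products. *)
Lemma area_hex_strips A B C : proper_hex A B C ->
    cross B C < cross A B + cross A C -> cross A B < cross B C + cross A C ->
  area (hex_strips A B C) = (cross A B + cross B C + cross A C)%:E.
Proof.
move=> [ab bc ac tC tB tA] X0 Y0.
set al := cross A B; set be := cross B C; set ga := cross A C.
have ga0 : ga != 0 by rewrite gt_eqF.
pose p := (ga - be + al) / ga; pose q := (ga + be - al) / ga.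
pose a11 := (A.2 + C.2) / ga; pose a12 := - (A.1 + C.1) / ga.
have Mdet : a11 * A.1 - a12 * - A.2 = 1.
  by rewrite /a11 /a12 /ga /cross; field.
have -> : hex_strips A B C = linmap a11 a12 (- A.2) A.1 @^-1`
    normal_strips al be ga p q.
  have e1 v : cross v (B - A) =
      al * (a11 * v.1 + a12 * v.2) + p * (- A.2 * v.1 + A.1 * v.2).
    by move: ga0; rewrite /p /a11 /a12 /ga /be /al /cross /= => ?; field.
  have e2 v : cross v (C - B) =
      (ga - al) * (a11 * v.1 + a12 * v.2) + q * (- A.2 * v.1 + A.1 * v.2).
    by move: ga0; rewrite /q /a11 /a12 /ga /be /al /cross /= => ?; field.
  have e3 v : `|cross v (A + C)| = ga * `|a11 * v.1 + a12 * v.2|.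
    rewrite -[X in X * _](ger0_norm (ltW ac)) -normrM; congr `|_|.
    by move: ga0; rewrite /a11 /a12 /ga /cross /= => ?; field.
  have ga_le1 z : (ga * z <= ga) = (z <= 1) by rewrite ger_pMr.
  by apply/seteqP; split=> v; rewrite /hex_strips /normal_strips /linmap /=;
    rewrite e1 e2 e3 ga_le1.
rewrite area_SL2; [|by move: Mdet; lra|exact: measurable_normal_strips].
apply: area_normal_strips => //; rewrite /p /q ?divr_gt0//.
- by rewrite /al /be /ga; lra.
- by rewrite /al /be /ga; lra.
- by field.
- by field.
Qed.

End HexagonArea.

(** * Norms on the plane *)

(** The last field gives both definiteness and the comparison with the maximum
norm. *)
Record planar_norm (R : realType) := PlanarNorm {
  pnorm :> R * R -> R;
  pnormZ : forall c v, pnorm (c *: v) = `|c| * pnorm v;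
  pnormD : forall u v, pnorm (u + v) <= pnorm u + pnorm v;
  pnorm_coord : exists2 c, 0 < c &
    forall v, `|v.1| <= c * pnorm v /\ `|v.2| <= c * pnorm v }.

Section PlanarNorm.
Variables (R : realType) (N : planar_norm R).
Implicit Types (u v w x y : R * R).

Definition unit_ball : set (R * R) := [set v | N v <= 1].

Lemma pnorm_ge0 v : 0 <= N v.
Proof.
have [c c0 /(_ v)[le1 _]] := pnorm_coord N.
by rewrite -(pmulr_rge0 _ c0); apply: le_trans le1.
Qed.

Lemma pnorm0 : N 0 = 0.
Proof. by rewrite -(scale0r (0 : R * R)) pnormZ normr0 mul0r. Qed.

Lemma pnormN v : N (- v) = N v.
Proof. by rewrite -scaleN1r pnormZ normrN1 mul1r. Qed.

Lemma pnorm_gt0 v : v != 0 -> 0 < N v.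
Proof.
move=> v0; rewrite lt_neqAle pnorm_ge0 andbT eq_sym; apply: contra v0 => /eqP Nv0.
have [c c0 /(_ v)] := pnorm_coord N; rewrite Nv0 mulr0 !normr_le0.
by case: v {Nv0} => v1 v2 /= [/eqP-> /eqP->].
Qed.

Lemma pnormB u v : N (u - v) = N (v - u).
Proof. by rewrite -opprB pnormN. Qed.

Lemma pnorm_bound : exists2 M, 0 < M & forall v, N v <= M * (`|v.1| + `|v.2|).
Proof.
exists (N (1, 0) + N (0, 1) + 1).
  by rewrite ltr_wpDl// addr_ge0// pnorm_ge0.
move=> v; rewrite {1}(_ : v = v.1 *: (1, 0) + v.2 *: (0, 1)); last first.
  by case: v => a b; congr pair => /=; rewrite /GRing.scale /=; ring.
apply: le_trans (pnormD _ _ _) _; rewrite !pnormZ.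
have := pnorm_ge0 (1, 0); have := pnorm_ge0 (0, 1).
by have := normr_ge0 v.1; have := normr_ge0 v.2; nra.
Qed.

Lemma pnorm_continuous : continuous N.
Proof.
have [M M0 NM] := pnorm_bound.
move=> x; apply/cvgrPdist_lt => e e0.
have d0 : 0 < e / M / 2 by rewrite !divr_gt0.
near=> y.
have yx1 : `|x.1 - y.1| < e / M / 2.
  by near: y; apply: cvgr_dist_lt => //; exact: cvg_fst.
have yx2 : `|x.2 - y.2| < e / M / 2.
  by near: y; apply: cvgr_dist_lt => //; exact: cvg_snd.
have : N (x - y) < e.
  apply: le_lt_trans (NM _) _; rewrite -ltr_pdivlMl//.
  by rewrite /= [ltRHS]mulrC [ltRHS]splitr ltrD.
apply: le_lt_trans; rewrite ler_norml.
have := pnormD N (x - y) y; have := pnormD N (y - x) x.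
by rewrite !subrK [N (y - x)]pnormB; lra.
Unshelve. all: by end_near. Qed.

Lemma interior_unit_ball x : interior unit_ball x <-> N x < 1.
Proof.
split=> [/(interior_segment x)[e e0 eK]|Nx].
  have /eK : `|e / 2| < e by rewrite gtr0_norm; lra.
  rewrite /unit_ball /= -[X in X + _]scale1r -scalerDl pnormZ ger0_norm; last by lra.
  have := pnorm_ge0 x; nra.
have near1 : \forall y \near x, N y < 1.
  exact: cvgr_lt (@pnorm_continuous x) _ Nx.
exact: (filterS (fun y (Ny : N y < 1) => ltW Ny) near1).
Qed.

Lemma boundary_unit_ball x : boundary unit_ball x <-> N x = 1.
Proof.
have cK : closed unit_ball.
  rewrite (_ : unit_ball = N @^-1` [set y | y <= 1])//.
  by apply: preimage_closed; [move=> y _; exact: pnorm_continuous|exact: closed_le].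
rewrite /boundary closure_id in cK; rewrite /boundary -cK; split.
  move=> [/= Nx1 /interior_unit_ball/negP]; rewrite -leNgt => Nx2.
  by apply/eqP; rewrite eq_le Nx1.
move=> Nx; split; first by rewrite /unit_ball /= Nx.
by move=> /interior_unit_ball; rewrite Nx ltxx.
Qed.

End PlanarNorm.

(** * Lattice reduction to equilateral pairs *)

Section Reduction.
Variables (R : realType) (N : planar_norm R).
Implicit Types (u v w x y : R * R).

Definition equilateral u w := [/\ N u = 1, N w = 1 & N (w - u) = 1].

(** As t runs from 1 to -1, the direction of c t turns from u to - u on one side
of the line of u, and the distance from u to the unit vector in this direction
goes from 0 to 2. The function g is that distance minus 1, scaled by N (c t) so
that no division is needed. *)
Lemma equilateral_exists u : N u = 1 ->
  exists2 x, equilateral u x & 0 < cross u x.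
Proof.
move=> Nu; pose v : R * R := (- u.2, u.1).
have uv : 0 < cross u v.
  rewrite /cross /v /= mulrN opprK -!expr2 lt_neqAle addr_ge0 ?sqr_ge0// andbT.
  rewrite eq_sym paddr_eq0 ?sqr_ge0// !sqrf_eq0; apply/negP => /andP[/eqP u1 /eqP u2].
  have u0 : u = 0 by move: u1 u2; case: (u) => a b /= -> ->.
  by move: Nu; rewrite u0 pnorm0 => /eqP; rewrite eq_sym oner_eq0.
pose c (t : R) : R * R := t *: u + (1 - `|t|) *: v.
have cc : continuous c.
  move=> t; apply: cvgD; apply: cvgZr_tmp; first exact: cvg_id.
  by apply: cvgB; [exact: cvg_cst|apply: cvg_norm; exact: cvg_id].
have cN : continuous (fun t => N (c t)).
  by move=> t; apply: continuous_comp; [exact: cc|exact: pnorm_continuous].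
pose g t := N (c t - N (c t) *: u) - N (c t).
have gc : continuous g.
  move=> t; apply: cvgB; last exact: cN.
  apply: (@continuous_comp _ _ _ (fun t => c t - N (c t) *: u) N);
    last exact: pnorm_continuous.
  by apply: cvgB; [exact: cc|apply: cvgZr_tmp; exact: cN].
have c1 : c 1 = u by rewrite /c normr1 subrr scale1r scale0r addr0.
have cN1 : c (-1) = - u by rewrite /c normrN1 subrr scaleN1r scale0r addr0.
have g1 : g 1 = -1 by rewrite /g c1 Nu scale1r subrr pnorm0 sub0r.
have gN1 : g (-1) = 1.
  rewrite /g cN1 pnormN Nu scale1r -opprD pnormN.
  by rewrite -[u + u](scaler_nat 2 u) pnormZ Nu mulr1 ger0_norm//; lra.
have [|||t tI gt0] := @IVT R g (-1) 1 0; first by lra.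
- exact: continuous_subspaceT.
- by rewrite g1 gN1; rewrite ge_min le_max; lra.
move: tI; rewrite in_itv /= => /andP[tl tr].
have t1 : `|t| < 1.
  rewrite lt_neqAle ler_norml tl tr !andbT; apply/negP => /eqP t1.
  have [te|te] : t = 1 \/ t = -1.
    by move: t1; case: (ger0P t) => _ <-; [left|right; rewrite opprK].
  - by move: gt0; rewrite te g1; lra.
  - by move: gt0; rewrite te gN1; lra.
have uct : 0 < cross u (c t).
  have -> : cross u (c t) = (1 - `|t|) * cross u v.
    by rewrite /c crossC cross_linl crossvv mulr0 add0r -mulrN -crossC.
  by rewrite mulr_gt0// subr_gt0.
have ct0 : 0 < N (c t).
  by apply: pnorm_gt0; apply: contraTneq uct => ->; rewrite cross0r ltxx.
exists ((N (c t))^-1 *: c t); last first.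
  have -> : cross u ((N (c t))^-1 *: c t) = (N (c t))^-1 * cross u (c t).
    by rewrite /cross /= /GRing.scale /=; ring.
  by rewrite mulr_gt0// invr_gt0.
have ctn : `|(N (c t))^-1| * N (c t) = 1.
  by rewrite ger0_norm ?invr_ge0 ?(ltW ct0)// mulVf ?gt_eqF.
split=> //; first by rewrite pnormZ.
have -> : (N (c t))^-1 *: c t - u = (N (c t))^-1 *: (c t - N (c t) *: u).
  by rewrite scalerBr scalerA mulVf ?gt_eqF// scale1r.
by rewrite pnormZ; move/eqP: gt0; rewrite subr_eq0 => /eqP ->.
Qed.

(** By Cramer's rule the coefficients of a vector in a basis are linear forms of
its coordinates. *)
Lemma pnorm_coef_bound u0 w0 : cross u0 w0 != 0 ->
  exists2 k, 0 <= k & forall s t, `|s| <= k * N (s *: u0 + t *: w0) /\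
    `|t| <= k * N (s *: u0 + t *: w0).
Proof.
move=> D0; have [c c0 cN] := pnorm_coord N.
pose k := c * (`|u0.1| + `|u0.2| + `|w0.1| + `|w0.2|) / `|cross u0 w0|.
have dpos : 0 < `|cross u0 w0| by rewrite normr_gt0.
exists k; first by rewrite divr_ge0 ?mulr_ge0 ?addr_ge0// ltW.
move=> s t; set v := s *: u0 + t *: w0.
have [v1 v2] := cN v.
have crossN z : `|z.1| <= `|u0.1| + `|w0.1| -> `|z.2| <= `|u0.2| + `|w0.2| ->
    `|cross v z| <= c * (`|u0.1| + `|u0.2| + `|w0.1| + `|w0.2|) * N v.
  move=> z1 z2; rewrite /cross; apply: le_trans (ler_normB _ _) _.
  rewrite !normrM.
  have := ler_pM (normr_ge0 _) (normr_ge0 _) v1 z2.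
  by have := ler_pM (normr_ge0 _) (normr_ge0 _) v2 z1; lra.
have vw : cross v w0 = s * cross u0 w0 by rewrite cross_linl crossvv mulr0 addr0.
have vu : cross v u0 = - (t * cross u0 w0).
  by rewrite cross_linl crossvv mulr0 add0r -mulrN -crossC.
rewrite /k mulrAC !ler_pdivlMr// -!normrM -vw -[`|t * _|]normrN -vu.
by split; apply: crossN; rewrite ?lerDl ?lerDr.
Qed.

(** Only finitely many lattice vectors are at most as long as u0, since their
coefficients are bounded. *)
Lemma shortest_lattice_vector u0 w0 : cross u0 w0 != 0 ->
  exists a b : int, (a, b) != (0, 0) /\
    forall c d : int, (c, d) != (0, 0) ->
      N (u0 *~ a + w0 *~ b) <= N (u0 *~ c + w0 *~ d).
Proof.
move=> D0; have [k k0 kN] := pnorm_coef_bound D0.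
pose F (z : int * int) := N (u0 *~ z.1 + w0 *~ z.2).
pose n := Num.bound (k * F (1, 0)).
have nP : k * F (1, 0) < n%:R by apply: archi_boundP; rewrite mulr_ge0// pnorm_ge0.
have small z : F z <= F (1, 0) -> (`|z.1| < n%:Z) /\ (`|z.2| < n%:Z).
  move=> zF; have := kN z.1%:~R z.2%:~R; rewrite !scaler_int -[N _]/(F z).
  have kz : k * F z < n%:R by apply: le_lt_trans nP; exact: ler_wpM2l.
  rewrite -!intr_norm => -[h1 h2].
  by split; rewrite -(ltr_int R) -[n%:~R]/(n%:R); [apply: le_lt_trans kz|apply: le_lt_trans kz].
pose I := 'I_(n.*2.+1).
pose G (i : I * I) : int * int := (i.1%:Z - n%:Z, i.2%:Z - n%:Z).
have Gs z : F z <= F (1, 0) -> exists i, G i = z.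
  move=> /small[z1 z2].
  have i1 : (`|(z.1 + n%:Z)%R| < n.*2.+1)%N by lia.
  have i2 : (`|(z.2 + n%:Z)%R| < n.*2.+1)%N by lia.
  exists (Ordinal i1, Ordinal i2); case: z z1 z2 i1 i2 => z1 z2 /= *.
  by congr pair; rewrite /G /=; lia.
have [i0 Gi0] := Gs (1, 0) (lexx _).
have Pi0 : G i0 != (0, 0) by rewrite Gi0.
case: (@Order.TotalTheory.arg_minP _ _ _ i0 (fun i => G i != (0, 0)) (F \o G) Pi0)
  => i iP imin.
exists (G i).1, (G i).2; split; first by rewrite -surjective_pairing.
move=> c d cd; rewrite -[leLHS]/(F (G i)) -[leRHS]/(F (c, d)).
have [le|lt] := leP (F (c, d)) (F (1, 0)).
  by have [j jE] := Gs _ le; rewrite -jE; apply: imin; rewrite jE.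
apply: le_trans (ltW lt).
by have := imin i0 Pi0; rewrite /= Gi0.
Qed.

(** Divide the lattice by the norm lam of a shortest vector u; this cannot
increase the determinant d, because lam is at least 1. Let (u1, x) be an
equilateral pair with u1 = u / lam. The lattice points of the layer next to the
line of u1 are spaced by u1. If this layer were closer to that line than x, the
segment that it cuts from the quadrilateral with vertices - u1, u1, x, x - u1
would have length greater than 1, and one of these points would have norm less
than 1. *)
Lemma lattice_reduction L d : lattice_with_det L d -> admissible (unit_ball N) L ->
  exists u w, equilateral u w /\ 0 < cross u w <= d.
Proof.
move=> [u0 [w0 [D0 LE dE]]] adm.
have [a [b [ab0 amin]]] := shortest_lattice_vector D0.
have LP (c e : int) : L (u0 *~ c + w0 *~ e) by rewrite LE; exists c, e.
set u := u0 *~ a + w0 *~ b in amin.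
have crossL (c e c' e' : int) : cross (u0 *~ c + w0 *~ e) (u0 *~ c' + w0 *~ e') =
    (c * e' - e * c')%:~R * cross u0 w0.
  rewrite -![u0 *~ _]scaler_int -![w0 *~ _]scaler_int.
  by rewrite rmorphB !rmorphM /cross /= /GRing.scale /=; ring.
have nz (c e : int) : (c, e) != (0, 0) -> u0 *~ c + w0 *~ e != 0.
  move=> ce; apply/eqP => z0.
  have := crossL c e 0 1; rewrite z0 cross0l => /esym/eqP.
  rewrite mulf_eq0 (negbTE D0) orbF intr_eq0 mulr1 mulr0 subr0 => /eqP c0.
  have := crossL c e 1 0; rewrite z0 cross0l => /esym/eqP.
  rewrite mulf_eq0 (negbTE D0) orbF intr_eq0 mulr1 mulr0 sub0r oppr_eq0 => /eqP e0.
  by move: ce; rewrite c0 e0 eqxx.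
have N1 (c e : int) : (c, e) != (0, 0) -> 1 <= N (u0 *~ c + w0 *~ e).
  move=> ce; rewrite leNgt; apply/negP => /interior_unit_ball/(adm _ (LP c e))/eqP.
  exact/negP/nz.
have Nu1 : 1 <= N u by exact: N1.
have Nu0 : 0 < N u by lra.
(* A shortest vector is primitive, so the lattice has a basis containing it. *)
have cop : coprimez a b.
  rewrite /coprimez; set g := gcdz a b.
  have g0 : g != 0.
    by rewrite /g gcdz_eq0; apply: contra ab0 => /andP[/eqP-> /eqP->].
  have /dvdzP[a' aE] := dvdz_gcdl a b; have /dvdzP[b' bE] := dvdz_gcdr a b.
  rewrite -/g in aE bE.
  have ab'0 : (a', b') != (0, 0).
    by apply: contra ab0 => /eqP[a0 b0]; rewrite aE bE a0 b0 !mul0r.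
  have uE : u = g%:~R *: (u0 *~ a' + w0 *~ b').
    by rewrite /u aE bE !mulrzA scalerDr !scaler_int.
  have := amin _ _ ab'0; rewrite {1}uE pnormZ -intr_norm ger_pMl; last first.
    exact/pnorm_gt0/nz.
  have : 0 <= g by rewrite /g.
  by rewrite lerz1; lia.
have [e [f efE]] : exists e f : int, a * f - b * e = 1.
  have [s [t st]] := Bezoutz a b; exists (- t), s.
  by move: cop; rewrite /coprimez -st => /eqP <-; ring.
have [e' [f' [uv dpos]]] : exists e' f' : int,
    cross u (u0 *~ e' + w0 *~ f') = d /\ 0 < d.
  have [Dneg|Dpos|D00] := ltrgtP (cross u0 w0) 0; last 1 first.
  - by move: D0; rewrite D00 eqxx.
  - exists (- e), (- f); rewrite crossL dE ltr0_norm// oppr_gt0; split=> //.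
    have -> : a * - f - b * - e = -1 by rewrite -efE; ring.
    by rewrite mulrNz mulr1z mulN1r.
  - by exists e, f; rewrite crossL dE efE mulr1z mul1r gtr0_norm.
set v := u0 *~ e' + w0 *~ f' in uv.
set lam := N u in Nu1 Nu0.
pose u1 := lam^-1 *: u.
have Nu1E : N u1 = 1.
  by rewrite /u1 pnormZ ger0_norm ?invr_ge0 ?ltW// mulVf ?gt_eqF.
have [x [_ Nx Nxu] u1x] := equilateral_exists Nu1E.
exists u1, x; split=> //; rewrite u1x /=.
rewrite leNgt; apply/negP => dlt.
pose th := d / lam ^+ 2 / cross u1 x.
have th0 : 0 < th by rewrite !divr_gt0// exprn_gt0.
have th1 : th < 1.
  rewrite ltr_pdivrMr// mul1r; apply: le_lt_trans dlt.
  rewrite ler_pdivrMr ?exprn_gt0//.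
  have lam2 : 1 <= lam ^+ 2 by exact: exprn_ege1.
  by rewrite ler_peMr// ltW.
pose tau := cross (lam^-1 *: v) x / cross u1 x.
have vE : lam^-1 *: v = th *: x + tau *: u1.
  rewrite {1}(cross_basis (lam^-1 *: v) (lt0r_neq0 u1x)) addrC; congr (_ *: _ + _).
  rewrite /th -uv /u1 /cross /= /GRing.scale /=; congr (_ / _).
  by field; rewrite gt_eqF.
(* With r in ]-1, 0], the lattice point th x + r u1 of the layer lies in the
   quadrilateral. *)
pose k := Num.ceil tau; pose r := tau - k%:~R.
have [r1 r0] : -1 < r /\ r <= 0.
  have /andP[] := ceil_itv tau; rewrite -/k rmorphB /= mulr1z /r; split; lra.
have short : N (th *: x + r *: u1) < 1.
  have [rt|rt] := leP (- th) r.
    have -> : th *: x + r *: u1 = (th + r) *: x + (- r) *: (x - u1).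
      by apply: injective_projections; rewrite /= /GRing.scale /=; ring.
    apply: le_lt_trans (pnormD _ _ _) _; rewrite !pnormZ Nx Nxu !ger0_norm; lra.
  have -> : th *: x + r *: u1 = th *: (x - u1) + (th + r) *: u1.
    by apply: injective_projections; rewrite /= /GRing.scale /=; ring.
  apply: le_lt_trans (pnormD _ _ _) _; rewrite (pnormZ _ th) (pnormZ _ (th + r)) Nxu Nu1E.
  by rewrite ger0_norm ?ler0_norm; lra.
have pE : u0 *~ (e' - k * a) + w0 *~ (f' - k * b) = lam *: (th *: x + r *: u1).
  have -> : th *: x + r *: u1 = lam^-1 *: v - k%:~R *: u1.
    by rewrite vE /r scalerBl addrA.
  have -> : lam *: (lam^-1 *: v - k%:~R *: u1) = v - k%:~R *: u.
    by rewrite /u1 scalerBr !scalerA mulfV ?gt_eqF// scale1r mulrAC mulfV ?gt_eqF// mul1r.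
  rewrite /v /u; have latE (c e0 : int) :
    u0 *~ c + w0 *~ e0 = c%:~R *: u0 + e0%:~R *: w0 by rewrite !scaler_int.
  rewrite !latE !rmorphB !rmorphM.
  by apply: injective_projections; rewrite /= /GRing.scale /=; ring.
have /amin : (e' - k * a, f' - k * b) != (0, 0).
  apply/eqP => -[/subr0_eq ek /subr0_eq fk].
  have : cross u v = 0 by rewrite /v ek fk crossL; apply/eqP; rewrite mulf_eq0
    intr_eq0; apply/orP; left; apply/eqP; ring.
  by rewrite uv => d0; rewrite d0 ltxx in dpos.
by rewrite pE pnormZ (ger0_norm (ltW Nu0)) -/lam ler_pMr// leNgt short.
Qed.

End Reduction.

(** * The p-norm *)

Section LpNorm.
Variables (R : realType).
Implicit Types (u v w x y : R * R).

Lemma powR_convex (p t a b : R) : 1 <= p -> 0 <= t <= 1 -> 0 <= a -> 0 <= b ->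
  (t * a + (1 - t) * b) `^ p <= t * a `^ p + (1 - t) * b `^ p.
Proof.
move=> p1 /andP[t0 t1] a0 b0.
have := @convex_powR R p p1 (Itv01 t0 t1) a b.
by rewrite !convRE /= /unstable.onem; apply; rewrite inE /= in_itv /= andbT.
Qed.

Definition lp_sum (p : R) v := `|v.1| `^ p + `|v.2| `^ p.

Definition lp_gauge (p s : R) v := lp_sum p v `^ p^-1 / s.

Section Gauge.
Variables (p s : R).
Hypotheses (p1 : 1 <= p) (s0 : 0 < s).

Let p0 : 0 < p. Proof. exact: lt_le_trans p1. Qed.
Let pn0 : p != 0. Proof. by rewrite gt_eqF. Qed.

Lemma lp_sum_ge0 v : 0 <= lp_sum p v.
Proof. by rewrite addr_ge0// powR_ge0. Qed.

Lemma lp_sumZ (c : R) v : lp_sum p (c *: v) = `|c| `^ p * lp_sum p v.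
Proof. by rewrite /lp_sum /= /GRing.scale /= !normrM !powRM// mulrDr. Qed.

Lemma powRVK (a : R) : 0 <= a -> (a `^ p^-1) `^ p = a.
Proof. by move=> a0; rewrite -powRrM mulVf// powRr1. Qed.

Lemma powRKV (a : R) : 0 <= a -> (a `^ p) `^ p^-1 = a.
Proof. by move=> a0; rewrite -powRrM mulfV// powRr1. Qed.

Lemma lp_gaugeX v : (s * lp_gauge p s v) `^ p = lp_sum p v.
Proof.
by rewrite /lp_gauge mulrCA mulfV ?gt_eqF// mulr1 powRVK// lp_sum_ge0.
Qed.

Lemma lp_gauge_ge0 v : 0 <= lp_gauge p s v.
Proof. by rewrite divr_ge0 ?powR_ge0// ltW. Qed.

Lemma lp_gauge_le (k : R) v : 0 <= k ->
  (lp_gauge p s v <= k) = (lp_sum p v <= (s * k) `^ p).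
Proof.
move=> k0; have sk0 : 0 <= s * k by rewrite mulr_ge0// ltW.
rewrite /lp_gauge ler_pdivrMr// mulrC; apply/idP/idP => le.
  rewrite -(powRVK (lp_sum_ge0 v)); apply: ge0_ler_powR => //; first exact: ltW.
  by rewrite nnegrE powR_ge0.
rewrite -(powRKV sk0); apply: ge0_ler_powR => //.
- by rewrite invr_ge0 ltW.
- by rewrite nnegrE lp_sum_ge0.
- by rewrite nnegrE powR_ge0.
Qed.

Lemma lp_gaugeZ c v : lp_gauge p s (c *: v) = `|c| * lp_gauge p s v.
Proof.
by rewrite /lp_gauge lp_sumZ powRM ?powR_ge0 ?lp_sum_ge0// powRKV// mulrA.
Qed.

Lemma lp_sum_convex t u v : 0 <= t <= 1 ->
  lp_sum p (t *: u + (1 - t) *: v) <= t * lp_sum p u + (1 - t) * lp_sum p v.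
Proof.
move=> t01; have /andP[t0 t1] := t01.
have le1 (a b : R) : `|t * a + (1 - t) * b| `^ p <=
    t * `|a| `^ p + (1 - t) * `|b| `^ p.
  apply: le_trans (powR_convex p1 t01 (normr_ge0 a) (normr_ge0 b)).
  have tn : 0 <= 1 - t by lra.
  apply: ge0_ler_powR; rewrite ?nnegrE ?(ltW p0)//.
    by rewrite addr_ge0// mulr_ge0.
  by apply: le_trans (ler_normD _ _) _; rewrite !normrM !(ger0_norm t0) (ger0_norm tn).
by rewrite /lp_sum; have := le1 u.1 v.1; have := le1 u.2 v.2; rewrite /= /GRing.scale /=; lra.
Qed.

Lemma lp_gauge_coord v :
  `|v.1| <= s * lp_gauge p s v /\ `|v.2| <= s * lp_gauge p s v.
Proof.
rewrite /lp_gauge mulrCA mulfV ?gt_eqF// mulr1.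
have le (a b : R) : 0 <= a -> 0 <= b -> a <= (a `^ p + b `^ p) `^ p^-1.
  move=> a0 b0; rewrite -{1}(powRKV a0); apply: ge0_ler_powR.
  - by rewrite invr_ge0 ltW.
  - by rewrite nnegrE powR_ge0.
  - by rewrite nnegrE addr_ge0// powR_ge0.
  - by rewrite lerDl powR_ge0.
by split; [|rewrite /lp_sum addrC]; exact: le.
Qed.

(** The vector u + v is a + b times a convex combination of u / a and v / b,
where a and b are the gauges of u and v, and the unit ball is convex. *)
Lemma lp_gaugeD u v : lp_gauge p s (u + v) <= lp_gauge p s u + lp_gauge p s v.
Proof.
have gauge0 w : lp_gauge p s w = 0 -> w = 0.
  move=> w0; have := lp_gauge_coord w; rewrite w0 mulr0 !normr_le0.
  by case: w {w0} => ? ? /= [/eqP-> /eqP->].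
have := lp_gauge_ge0 u; have := lp_gauge_ge0 v.
move aE : (lp_gauge p s u) => a; move bE : (lp_gauge p s v) => b.
rewrite le_eqVlt => /predU1P[b0|b0].
  by rewrite -b0 in bE *; rewrite (gauge0 _ bE) !addr0 aE.
rewrite le_eqVlt => /predU1P[a0|a0].
  by rewrite -a0 in aE *; rewrite (gauge0 _ aE) !add0r bE.
have ab0 : 0 < a + b by exact: addr_gt0.
have uvE : u + v = (a + b) *: ((a / (a + b)) *: (a^-1 *: u) +
    (1 - a / (a + b)) *: (b^-1 *: v)).
  have e1 : (a + b) * (a / (a + b)) * a^-1 = 1.
    by field; rewrite !gt_eqF.
  have e2 : (a + b) * (1 - a / (a + b)) * b^-1 = 1.
    by field; rewrite !gt_eqF.
  by rewrite scalerDr !scalerA e1 e2 !scale1r.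
rewrite uvE lp_gaugeZ gtr0_norm// ger_pMr// lp_gauge_le// mulr1.
apply: le_trans (lp_sum_convex _ _ _) _.
  by rewrite divr_ge0 ?(ltW a0) ?(ltW ab0)//= ler_pdivrMr// mul1r lerDl ltW.
have unit w k : lp_gauge p s w = k -> 0 < k -> lp_sum p (k^-1 *: w) = s `^ p.
  move=> <- w0; rewrite -lp_gaugeX lp_gaugeZ ger0_norm ?invr_ge0 ?ltW//.
  by rewrite mulVf ?gt_eqF// mulr1.
by rewrite (unit u) ?(unit v)// -mulrDl addrCA subrr addr0 mul1r.
Qed.

Definition lp_norm : planar_norm R :=
  PlanarNorm lp_gaugeZ lp_gaugeD (ex_intro2 _ _ s s0 lp_gauge_coord).

Lemma dilate_lp_disc : dilate s (lp_disc p) = unit_ball lp_norm.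
Proof.
apply/seteqP; split=> v.
  move=> [w wp <-]; rewrite /unit_ball /=.
  rewrite -[(_, _)]/(s *: w) lp_gaugeZ gtr0_norm//.
  rewrite /lp_gauge mulrCA mulfV ?gt_eqF// mulr1.
  rewrite [leRHS](_ : 1 = 1 `^ p^-1); last by rewrite powR1.
  apply: ge0_ler_powR => //.
  - by rewrite invr_ge0 ltW.
  - by rewrite nnegrE lp_sum_ge0.
  - by rewrite nnegrE.
rewrite /unit_ball /= => Nv; exists (s^-1 *: v).
  rewrite /lp_disc /= -[X in X <= _]/(lp_sum p (s^-1 *: v)) lp_sumZ.
  have : lp_sum p v <= s `^ p by rewrite -[s in s `^ _]mulr1 -lp_gauge_le.
  rewrite ger0_norm ?invr_ge0 ?(ltW s0)// => le.
  apply: (le_trans (ler_wpM2l (powR_ge0 _ _) le)).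
  by rewrite -powRM ?invr_ge0 ?(ltW s0)// mulVf ?gt_eqF// powR1.
by case: v Nv => v1 v2 _ /=; rewrite /GRing.scale /= !mulrA mulfV ?gt_eqF// !mul1r.
Qed.

End Gauge.
End LpNorm.

(** * Tangent hexagons of equilateral pairs *)

Section Duality.
Variables (R : realType) (N : planar_norm R).
Implicit Types (u v w x y : R * R).

Lemma side_opp A B C i x : side (hex A B C) i x -> side (hex A B C) (i + 3%:R) (- x).
Proof.
have opp P Q : [set ((1 - t) * P.1 + t * Q.1, (1 - t) * P.2 + t * Q.2) |
    t in `[(0 : R), 1]] x -> [set ((1 - t) * (- P).1 + t * (- Q).1,
    (1 - t) * (- P).2 + t * (- Q).2) | t in `[(0 : R), 1]] (- x).
  by move=> [t tI <-]; exists t => //; congr pair => /=; ring.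
rewrite /side; have negh j : hex A B C (j + 3%:R) = - hex A B C j.
  by move: j; apply: ord6_ind; rewrite !inordD3 !hexE ?opprK.
by rewrite addrAC !negh; exact: opp.
Qed.

Lemma hex_areas_mem A B C u v w : proper_hex A B C ->
    cross B C < cross A B + cross A C -> cross A B < cross B C + cross A C ->
    unit_ball N `<=` hexagon_region (hex A B C) ->
    injective (hex u v w) -> N u = 1 -> N v = 1 -> N w = 1 ->
    side (hex A B C) (inord 0) u -> side (hex A B C) (inord 1) v ->
    side (hex A B C) (inord 2) w ->
  hexagon_areas (unit_ball N) (cross A B + cross B C + cross A C).
Proof.
move=> pABC X0 Y0 KH inj_uvw Nu Nv Nw su sv sw; exists (hex A B C).
have Nhex i : N (hex u v w i) = 1.
  by move: i; apply: ord6_ind; rewrite hexE ?pnormN.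
have shex i : side (hex A B C) i (hex u v w i).
  have := side_opp su; have := side_opp sv; have := side_opp sw.
  by rewrite !inordD3 => sw' sv' su'; move: i; apply: ord6_ind; rewrite hexE.
split.
- exact: hex_convex.
- split=> // i; exists (hex u v w i); split; first exact: shex.
  by rewrite /unit_ball /= Nhex.
- exists (hex u v w); split=> //.
    by move=> i; split; [apply/boundary_unit_ball; exact: Nhex|exact: shex].
  by apply: ord6_ind; rewrite !inordD3 !hexE ?opprK.
- by rewrite hexagon_region_hex// area_hex_strips.
Qed.

Definition dot u v := u.1 * v.1 + u.2 * v.2.

Lemma dotDr u v w : dot u (v + w) = dot u v + dot u w.
Proof. by rewrite /dot /=; ring. Qed.

Lemma dotNr u v : dot u (- v) = - dot u v.
Proof. by rewrite /dot /=; ring. Qed.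

Lemma dotZr (c : R) u v : dot u (c *: v) = c * dot u v.
Proof. by rewrite /dot /= /GRing.scale /=; ring. Qed.

Lemma dot_eq u v x y : cross x y != 0 -> dot u x = dot v x -> dot u y = dot v y ->
  u = v.
Proof.
rewrite /dot /cross => D0 ex ey; apply: injective_projections.
  apply: (mulIf D0); have := congr1 ( *%R y.2) ex.
  by have := congr1 ( *%R x.2) ey; lra.
apply: (mulIf D0); have := congr1 ( *%R y.1) ex.
by have := congr1 ( *%R x.1) ey; lra.
Qed.

(** The gradient of a smooth and strictly convex norm on its unit circle: dual u is
the linear form of norm 1 that takes the value 1 at u. The field dual_smooth
says that the tangent at u is the only line through u that misses the open unit
ball, and dual_inj that distinct points have distinct tangents. *)
Record duality_map := DualityMap {
  dual :> R * R -> R * R;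
  dual_diag : forall u, N u = 1 -> dot (dual u) u = 1;
  dual_le : forall u x, N u = 1 -> `|dot (dual u) x| <= N x;
  dual_smooth : forall u d, N u = 1 -> (forall t, 1 <= N (u + t *: d)) ->
    dot (dual u) d = 0;
  dual_inj : forall u v, N u = 1 -> N v = 1 -> dual u = dual v -> u = v }.

Section DualHexagon.
Variable J : duality_map.

(** If dual u took the value 1 at v, the tangent at u would be a supporting line
at v as well, hence the tangent at v. *)
Lemma dual_lt1 u v : N u = 1 -> N v = 1 -> u != v -> dot (J u) v < 1.
Proof.
move=> Nu Nv uv; rewrite lt_neqAle; apply/andP; split; last first.
  by apply: le_trans (ler_norm _) _; rewrite -Nv; exact: dual_le.
apply: contra uv => /eqP Juv; apply/eqP/(@dual_inj J _ _ Nu Nv).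
pose d : R * R := (- (J u).2, (J u).1).
have Jud : dot (J u) d = 0 by rewrite /dot /=; ring.
have Jvd : dot (J v) d = 0.
  apply: dual_smooth => // t; rewrite -[1]Juv -[dot _ v]addr0 -[0](mulr0 t) -Jud.
  by rewrite -dotZr -dotDr; apply: le_trans (ler_norm _) _; exact: dual_le.
apply: (@dot_eq (J u) (J v) v d); rewrite ?Jud ?Jvd ?Juv ?dual_diag//.
suff -> : cross v d = 1 by rewrite oner_eq0.
by rewrite -Juv /cross /dot /d /=; ring.
Qed.

Lemma dot_cross_expand f u w x :
  cross u w * dot f x = cross x w * dot f u + cross u x * dot f w.
Proof. by rewrite /cross /dot; ring. Qed.

Lemma side_affine h i (t : R) x : 0 <= t <= 1 ->
  x = h i + t *: (h (i + 1) - h i) -> side h i x.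
Proof.
move=> t01 ->; exists t; first by rewrite /= in_itv.
by apply: injective_projections; rewrite /= /GRing.scale /=; ring.
Qed.

(** The hexagon is bounded by the tangents at the six points u, w, w - u and
their opposites. With a = dual u w, b = dual w u and c = - dual (w - u) u, its
vertices A, B, C are explicit, and its area is
  cross u w * (4 - (a (1 - b) c - (1 - a) b (1 - c)) ^ 2 / (D1 D2 D3)).
The numbers a, b, c lie strictly between 0 and 1 by strict convexity, so the
hexagon does not degenerate. *)
Lemma dual_hexagon u w : equilateral N u w -> 0 < cross u w ->
  exists2 s, hexagon_areas (unit_ball N) s & s <= 4 * cross u w.
Proof.
move=> [Nu Nw Nz]; set z := w - u in Nz; set de := cross u w => de0.
have u0 : u != 0 by apply: contraTneq de0 => u0; rewrite /de u0 cross0l ltxx.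
have w0 : w != 0 by apply: contraTneq de0 => w0; rewrite /de w0 cross0r ltxx.
have NN x : N x = 1 -> N (- x) = 1 by rewrite pnormN.
have Jz x : dot (J x) z = dot (J x) w - dot (J x) u by rewrite /z dotDr dotNr.
pose a := dot (J u) w; pose b := dot (J w) u; pose c := - dot (J z) u.
have Juu := dual_diag J Nu; have Jww := dual_diag J Nw.
have Jzw : dot (J z) w = 1 - c by have := dual_diag J Nz; rewrite Jz /c; lra.
have wE : w = z + u by rewrite /z subrK.
have uw : u != w by apply: contraTneq de0 => uw; rewrite /de uw crossvv ltxx.
have zw : z != w by apply: contraNneq u0 => zw; rewrite -(addKr z u) -wE zw addNr.
have uz : u != - z by apply: contraNneq w0 => uz; rewrite wE uz subrr.
have wz : w != z by rewrite eq_sym.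
have zu : z != - u by apply: contraNneq uz => ->; rewrite opprK.
have a1 : a < 1 by exact: dual_lt1.
have a0 : 0 < a by have := dual_lt1 Nu (NN _ Nz) uz; rewrite dotNr Jz Juu -/a; lra.
have b1 : b < 1 by apply: dual_lt1; rewrite // eq_sym.
have b0 : 0 < b by have := dual_lt1 Nw Nz wz; rewrite Jz Jww -/b; lra.
have c1 : c < 1 by have := dual_lt1 Nz (NN _ Nu) zu; rewrite dotNr -/c.
have c0 : 0 < c by have := dual_lt1 Nz Nw zw; rewrite Jzw; lra.
have [Juw Jwu Jzu] : [/\ dot (J u) w = a, dot (J w) u = b & dot (J z) u = - c].
  by rewrite /c opprK.
clearbody a b c.
(* In the basis (u, w) the three forms are (1, a), (b, 1) and (- c, 1 - c); D1, D2
   and D3 are the determinants of adjacent forms. *)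
pose D1 := 1 - a * b; pose D2 := b + c - b * c; pose D3 := 1 - c + a * c.
have D1p : 0 < D1 by rewrite /D1; nra.
have D2p : 0 < D2 by rewrite /D2; nra.
have D3p : 0 < D3 by rewrite /D3; nra.
have [a01 b01 c01] : [/\ 0 < 1 - a, 0 < 1 - b & 0 < 1 - c] by rewrite !subr_gt0.
have [D1n D2n D3n] : [/\ D1 != 0, D2 != 0 & D3 != 0] by rewrite !gt_eqF.
(* The lengths of three consecutive sides, as multiples of the direction vectors
   w - a u, b w - u and - (1 - c) u - c w. *)
pose e1 := (1 - b) / D1 + (1 - c) / D3.
pose e2 := c / D2 + (1 - a) / D1.
pose e3 := b / D2 + a / D3.
have e1p : 0 < e1 by rewrite addr_gt0// divr_gt0// subr_gt0.
have e2p : 0 < e2 by rewrite addr_gt0// divr_gt0// subr_gt0.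
have e3p : 0 < e3 by rewrite addr_gt0// divr_gt0.
pose A := ((1 - c + a) / D3) *: u + (- (1 - c) / D3) *: w.
pose B := ((1 - a) / D1) *: u + ((1 - b) / D1) *: w.
pose C := (- c / D2) *: u + ((b + c) / D2) *: w.
have AB : cross A B = e1 * de.
  by rewrite cross_lin2; congr (_ * _); rewrite /e1;
    move: D1n D3n; rewrite /D1 /D3 => *; field; apply/andP.
have BC : cross B C = e2 * de.
  by rewrite cross_lin2; congr (_ * _); rewrite /e2;
    move: D1n D2n; rewrite /D1 /D2 => *; field; apply/andP.
have AC : cross A C = e3 * de.
  by rewrite cross_lin2; congr (_ * _); rewrite /e3;
    move: D3n D2n; rewrite /D3 /D2 => *; field; apply/andP.
have BA_E : B - A = e1 *: ((- a) *: u + 1 *: w).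
  by rewrite linB linZ; apply: eq_lin; rewrite /e1;
    move: D1n D3n; rewrite /D1 /D3 => *; field; apply/andP.
have CB_E : C - B = e2 *: ((- 1) *: u + b *: w).
  by rewrite linB linZ; apply: eq_lin; rewrite /e2;
    move: D1n D2n; rewrite /D1 /D2 => *; field; apply/andP.
have AC_E : A + C = e3 *: ((1 - c) *: u + c *: w).
  by rewrite linD linZ; apply: eq_lin; rewrite /e3;
    move: D3n D2n; rewrite /D3 /D2 => *; field; apply/andP.
have D123n : (D1 != 0) && (D2 != 0) && (D3 != 0) by rewrite D1n D2n D3n.
have tZ : e1 + e2 - e3 = e1 * e2 * D1.
  by move: D123n; rewrite /e1 /e2 /e3 /D1 /D2 /D3 => /andP[/andP[? ?] ?]; field;
    do ?[apply/andP; split].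
have tY : e2 + e3 - e1 = e2 * e3 * D2.
  by move: D123n; rewrite /e1 /e2 /e3 /D1 /D2 /D3 => /andP[/andP[? ?] ?]; field;
    do ?[apply/andP; split].
have tX : e1 + e3 - e2 = e1 * e3 * D3.
  by move: D123n; rewrite /e1 /e2 /e3 /D1 /D2 /D3 => /andP[/andP[? ?] ?]; field;
    do ?[apply/andP; split].
have tot : e1 + e2 + e3 =
    4 - (a * (1 - b) * c - (1 - a) * b * (1 - c)) ^+ 2 / (D1 * D2 * D3).
  by move: D123n; rewrite /e1 /e2 /e3 /D1 /D2 /D3 => /andP[/andP[? ?] ?]; field;
    do ?[apply/andP; split].
have tZp : 0 < e1 + e2 - e3 by rewrite tZ !mulr_gt0.
have tYp : 0 < e2 + e3 - e1 by rewrite tY !mulr_gt0.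
have tXp : 0 < e1 + e3 - e2 by rewrite tX !mulr_gt0.
have tot4 : e1 + e2 + e3 <= 4.
  by rewrite tot lerBlDr lerDl divr_ge0 ?sqr_ge0// ltW// !mulr_gt0.
clear tot tX tY tZ.
have pABC : proper_hex A B C.
  by split; rewrite ?AB ?BC ?AC ?mulr_gt0// -mulrDl ler_pM2r//; lra.
have expand f x : de * dot f x = cross x w * dot f u + cross u x * dot f w.
  exact: dot_cross_expand.
have JK v x : N v = 1 -> N x <= 1 -> `|de * dot (J v) x| <= de.
  move=> Nv Nx; rewrite normrM gtr0_norm// ger_pMr//.
  by apply: le_trans Nx; exact: dual_le.
have KH : unit_ball N `<=` hexagon_region (hex A B C).
  move=> x Nx; rewrite hexagon_region_hex//.
  have stripE (e : R) v (D : R * R) : 0 < e -> N v = 1 ->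
      `|cross x D| = `|de * dot (J v) x| -> `|cross x (e *: D)| <= e * de.
    move=> ep Nv xD; rewrite -[e *: D]addr0 -(scale0r D) crossC cross_linl mul0r.
    rewrite addr0 normrN normrM gtr0_norm// ler_pM2l// crossC normrN xD.
    exact: JK.
  rewrite /hex_strips /= AB BC AC BA_E CB_E AC_E; split.
  - apply: (stripE _ u) => //; congr `|_|; rewrite expand Juu Juw.
    by rewrite crossC cross_linl [cross w x]crossC; ring.
  - apply: (stripE _ w) => //; congr `|_|; rewrite expand Jww Jwu.
    by rewrite crossC cross_linl [cross w x]crossC; ring.
  - apply: (stripE _ z) => //; rewrite -normrN; congr `|_|; rewrite expand Jzu Jzw.
    by rewrite crossC cross_linl [cross w x]crossC; ring.
exists (cross A B + cross B C + cross A C); last first.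
  by rewrite AB BC AC -!mulrDl ler_pM2r.
apply: (@hex_areas_mem A B C u w z) => //.
- by rewrite AB BC AC -mulrDl ltr_pM2r//; lra.
- by rewrite AB BC AC -mulrDl ltr_pM2r//; lra.
- exact/hex_inj/proper_hex_sub.
- have t0 : 0 <= (1 - c) / D3 by apply/ltW/divr_gt0.
  apply: (@side_affine _ _ ((1 - c) / D3 / e1)).
    rewrite divr_ge0 ?(ltW e1p)//= ler_pdivrMr// mul1r lerDr.
    by apply/ltW/divr_gt0.
  rewrite !inordS !hexE BA_E scalerA divfK ?gt_eqF// linZ linD.
  rewrite -[LHS]addr0 -{1}(scale1r u) -(scale0r w).
  by apply: eq_lin; rewrite /D3 in D3n *; field.
- have t0 : 0 <= (1 - a) / D1 by apply/ltW/divr_gt0.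
  apply: (@side_affine _ _ ((1 - a) / D1 / e2)).
    rewrite divr_ge0 ?(ltW e2p)//= ler_pdivrMr// mul1r lerDr.
    by apply/ltW/divr_gt0.
  rewrite !inordS !hexE CB_E scalerA divfK ?gt_eqF// linZ linD.
  rewrite -[LHS]add0r -{1}(scale1r w) -(scale0r u).
  by apply: eq_lin; rewrite /D1 in D1n *; field.
- have t0 : 0 <= b / D2 by apply/ltW/divr_gt0.
  apply: (@side_affine _ _ (b / D2 / e3)).
    rewrite divr_ge0 ?(ltW e3p)//= ler_pdivrMr// mul1r lerDl.
    by apply/ltW/divr_gt0.
  rewrite !inordS !hexE -opprD AC_E -scaleNr scalerA mulrN divfK ?gt_eqF// linZ linD.
  rewrite [LHS]addrC -{1}(scale1r w) -scaleN1r.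
  by apply: eq_lin; rewrite /D2 in D2n *; field.
Qed.

End DualHexagon.
End Duality.

(** * Symmetry of hexagons with opposite contact points *)

Section LowerBound.
Variables (R : realType) (N : planar_norm R) (J : duality_map N).
Implicit Types (u v w x y : R * R).

Lemma cross_kernel f w d x : dot f w = 0 -> dot f d = 0 -> dot f x = 1 -> cross w d = 0.
Proof.
move=> fw fd fx; have := dot_cross_expand f w d x.
by rewrite fw fd fx mulr1 !mulr0 addr0.
Qed.

Lemma cross_kernel_neq0 f x d : dot f x = 1 -> dot f d = 0 -> d != 0 -> cross x d != 0.
Proof.
move=> fx fd; apply: contra_neq => xd.
have := dot_cross_expand f x d (d.2, - d.1).
rewrite fx fd xd mul0r mulr0 addr0 mulr1 => /eqP; rewrite /cross /= mulNr opprK.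
rewrite -!expr2 eq_sym paddr_eq0 ?sqr_ge0// !sqrf_eq0 => /andP[/eqP d2 /eqP d1].
exact: injective_projections.
Qed.

(** Each side lies on a supporting line, hence on the tangent, at its contact
point. Consecutive tangents are not parallel: they meet at a vertex, where both
forms take the value 1, so they would coincide although their contact points
differ. Opposite contact points have opposite tangents, so the hexagon is
centrally symmetric and has an admissible lattice of a quarter of its area. *)
Lemma circumscribed_area_ge s : hexagon_areas (unit_ball N) s ->
  4 * critical_det (unit_ball N) <= s.
Proof.
move=> [h [cvx [KH _] [P [Pinj Pside Psym]] areah]].
have [hinj hcross] := cvx.
pose d i := h (i + 1) - h i.
have d0 i : d i != 0.
  by rewrite subr_eq0; apply/eqP => /hinj/eqP; rewrite addrC -subr_eq0 addrK.
have NP i : N (P i) = 1 by have [/boundary_unit_ball] := Pside i.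
have Pd i : exists t, P i = h i + t *: d i.
  have [_ [t _ tE]] := Pside i; exists t; rewrite -tE.
  by apply: injective_projections; rewrite /d /= /GRing.scale /=; ring.
have suppK i y : unit_ball N y -> cross y (d i) <= cross (h i) (d i).
  by move=> /KH/(convex_hexagon_region cvx)/(_ i); rewrite -/(d i) crossDr crossNr
    [cross (d i) y]crossC [cross (d i) (h i)]crossC; lra.
have supp i t : 1 <= N (P i + t *: d i).
  rewrite leNgt; apply/negP => /interior_unit_ball.
  move=> /(interior_cross_lt (d0 i) (suppK i)).
  have [t' ->] := Pd i; rewrite -addrA -scalerDl crossDl.
  rewrite -[_ *: d i]addr0 -(scale0r (d i)) cross_linl !crossvv !mulr0 !addr0.
  by rewrite ltxx.
have kill i : dot (J (P i)) (d i) = 0 by apply: dual_smooth => //; exact: supp.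
have killopp i : dot (J (P i)) (d (i + 3%:R)) = 0.
  apply: dual_smooth => // t; have := supp (i + 3%:R) (- t).
  by rewrite Psym scaleNr -opprD pnormN.
have on_line i : dot (J (P i)) (h i) = 1.
  have [t tE] := Pd i; have := dual_diag J (NP i).
  by rewrite {2}tE dotDr dotZr kill mulr0 addr0.
have on_line1 i : dot (J (P i)) (h (i + 1)) = 1.
  by rewrite -(on_line i) -[h (i + 1)](subrK (h i)) dotDr -/(d i) kill add0r.
have on_opp i : dot (J (P i)) (h (i + 3%:R)) = -1.
  have [t tE] := Pd (i + 3%:R); have := dual_diag J (NP i).
  by rewrite -{2}[P i]opprK -Psym tE dotNr dotDr dotZr killopp; lra.
have on_opp1 i : dot (J (P i)) (h (i + 3%:R + 1)) = -1.
  rewrite -(on_opp i) -[h (i + 3%:R + 1)](subrK (h (i + 3%:R))) dotDr.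
  by rewrite -/(d _) killopp add0r.
have nonpar i : cross (d i) (d (i + 1)) != 0.
  apply/eqP => par.
  have killd : dot (J (P (i + 1))) (d i) = 0.
    have hd := cross_kernel_neq0 (on_line (i + 1)) (kill (i + 1)) (d0 (i + 1)).
    have /eqP := dot_cross_expand (J (P (i + 1))) (h (i + 1)) (d (i + 1)) (d i).
    by rewrite kill par mul0r mulr0 addr0 mulf_eq0 (negbTE hd) => /eqP.
  have : P i = P (i + 1).
    apply: (@dual_inj _ _ J) => //.
    apply: (@dot_eq _ _ _ (h (i + 1)) (d i)); rewrite ?kill ?killd ?on_line ?on_line1//.
    exact: cross_kernel_neq0 (on_line1 i) (kill i) (d0 i).
  by move/Pinj/eqP; rewrite -[X in X == _]addr0 (inj_eq (addrI i)).
have hopp i : h (i + 3%:R) = - h i.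
  rewrite -(subrK 1 i); set j := i - 1.
  have w1 : cross (h (j + 1) + h (j + 3%:R + 1)) (d j) = 0.
    apply: (@cross_kernel (J (P j)) _ _ (P j)) => //; last exact: dual_diag.
    by rewrite dotDr on_line1 on_opp1 subrr.
  have w2 : cross (h (j + 1) + h (j + 3%:R + 1)) (d (j + 1)) = 0.
    apply: (@cross_kernel (J (P (j + 1))) _ _ (P (j + 1))) => //;
      last exact: dual_diag.
    by rewrite [j + 3%:R + 1]addrAC dotDr on_line on_opp subrr.
  rewrite [j + 1 + 3%:R]addrAC; apply/eqP; rewrite -addr_eq0 [_ + h _]addrC; apply/eqP.
  rewrite (cross_basis (h (j + 1) + h (j + 3%:R + 1)) (nonpar j)) w2 mul0r scale0r add0r.
  by rewrite crossC w1 oppr0 mul0r scale0r.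
pose A := h (inord 0); pose B := h (inord 1); pose C := h (inord 2).
have hE : h = hex A B C.
  apply/funext; apply: ord6_ind; rewrite !hexE// /A /B /C -hopp inordD3//.
have convd i : 0 < cross (d i) (d (i + 1)).
  rewrite lt_neqAle eq_sym nonpar /=.
  have := hcross i (i + 1 + 1); rewrite -/(d i).
  rewrite -[h (i + 1 + 1)](subrK (h (i + 1))) -addrA -/(d i) -/(d (i + 1)).
  by rewrite crossDr crossvv addr0.
have pos i : 0 < cross (h i) (h (i + 1)).
  have : cross 0 (d i) < cross (h i) (d i).
    apply: (interior_cross_lt (d0 i) (suppK i)).
    by apply/interior_unit_ball; rewrite pnorm0.
  by rewrite cross0l /d crossDr crossNr crossvv subr0.
have := pos (inord 0); have := pos (inord 1); have := pos (inord 2).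
have := convd (inord 0); have := convd (inord 1); have := convd (inord 2).
rewrite /d !inordS hE !hexE !crossE.
have := (crossC B A, crossC C B, crossC C A) => -[[-> ->] ->] t2 t1 t0 p2 p1 p0.
have pABC : proper_hex A B C by split; lra.
rewrite hE in KH areah.
move: areah; rewrite hexagon_region_hex// area_hex_strips//; try lra.
by move=> [<-]; exact: critical_det_le_hex.
Qed.

End LowerBound.

(** * Smoothness and strict convexity of the p-norm for p > 1 *)

Section SignedPower.
Variables (R : realType) (r : R).
Hypothesis r0 : 0 < r.
Let rn0 : r != 0. Proof. by rewrite gt_eqF. Qed.

(** The product of the sign of x and the r-th power of its absolute value, written
as a difference of two functions that are visibly continuous at 0. *)
Definition signed_powR (x : R) := Num.max x 0 `^ r - Num.max (- x) 0 `^ r.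

Lemma signed_powR_ge0 x : 0 <= x -> signed_powR x = x `^ r.
Proof.
by move=> x0; rewrite /signed_powR max_l// max_r ?oppr_le0// powR0// subr0.
Qed.

Lemma signed_powRN x : signed_powR (- x) = - signed_powR x.
Proof. by rewrite /signed_powR opprK opprB. Qed.

Lemma signed_powR_le0 x : x <= 0 -> signed_powR x = - (- x) `^ r.
Proof. by move=> x0; rewrite -[x]opprK signed_powRN signed_powR_ge0 ?opprK// oppr_ge0. Qed.

Lemma normr_signed_powR x : `|signed_powR x| = `|x| `^ r.
Proof.
have [x0|x0] := leP 0 x.
  by rewrite signed_powR_ge0// (ger0_norm (powR_ge0 _ _)) (ger0_norm x0).
by rewrite signed_powR_le0 ?(ltW x0)// normrN (ger0_norm (powR_ge0 _ _)) (ltr0_norm x0).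
Qed.

Lemma signed_powRM x : signed_powR x * x = `|x| `^ (r + 1).
Proof.
have r1 : 0 < r + 1 by rewrite addr_gt0.
have [x0|x0] := leP 0 x.
  by rewrite signed_powR_ge0// ger0_norm// -(mulr_powRB1 x0 r1) addrK mulrC.
have xN0 : 0 <= - x by rewrite oppr_ge0 ltW.
rewrite signed_powR_le0 ?(ltW x0)// mulNr -mulrN mulrC.
by rewrite ltr0_norm// -(mulr_powRB1 xN0 r1) addrK.
Qed.

Lemma signed_powR_inj : injective signed_powR.
Proof.
have inj0 x y : 0 <= x -> 0 <= y -> x `^ r = y `^ r -> x = y.
  by move=> x0 y0; apply: powR_injective; rewrite ?nnegrE.
have neg x y : 0 <= x -> y < 0 -> signed_powR x <> signed_powR y.
  move=> x0 y0; rewrite signed_powR_ge0// signed_powR_le0 ?(ltW y0)// => e.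
  have := powR_ge0 x r; have : 0 < (- y) `^ r by rewrite powR_gt0// oppr_gt0.
  by rewrite e; lra.
move=> x y; have [x0|x0] := leP 0 x; have [y0|y0] := leP 0 y.
- by rewrite !signed_powR_ge0//; exact: inj0.
- by move/neg; case.
- by move/esym/neg; case.
- rewrite !signed_powR_le0 ?ltW// => /oppr_inj e.
  by apply/oppr_inj/inj0 => //; rewrite oppr_ge0 ltW.
Qed.

Lemma continuous_powR_max0 : continuous (fun x : R => Num.max x 0 `^ r).
Proof.
move=> x; have [x0|x0|->] := ltgtP x 0.
- rewrite /continuous_at max_r ?(ltW x0)// powR0//.
  apply: cvg_near_cst; near=> y; rewrite max_r ?powR0//.
  by apply/ltW; near: y; exact: lt_nbhsl.
- rewrite /continuous_at max_l ?(ltW x0)//.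
  apply: (@cvg_trans _ ((fun y => y `^ r) @ x)).
    apply: near_eq_cvg; near=> y; rewrite max_l//.
    by apply/ltW; near: y; exact: lt_nbhsr.
  have : {for x, continuous (fun y : R => y `^ r)}; last exact.
  apply: differentiable_continuous; apply/derivable1_diffP.
  by have [] := is_derive1_powR r x0.
- rewrite /continuous_at maxxx powR0//; apply/cvgrPdist_lt => e e0.
  near=> y; rewrite sub0r normrN ger0_norm ?powR_ge0//.
  have yd : Num.max y 0 < e `^ r^-1.
    rewrite gt_max powR_gt0// andbT; near: y; apply: lt_nbhsl; exact: powR_gt0.
  rewrite -[ltRHS](_ : (e `^ r^-1) `^ r = _).
    by apply: gt0_ltr_powR; rewrite ?nnegrE ?powR_ge0// le_max lexx orbT.
  by rewrite -powRrM mulVf// powRr1// ltW.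
Unshelve. all: by end_near. Qed.

Lemma continuous_signed_powR : continuous signed_powR.
Proof.
move=> x; apply: cvgB; first exact: continuous_powR_max0.
apply: (@continuous_comp _ _ _ (fun y : R => - y) (fun x : R => Num.max x 0 `^ r)).
  by apply: cvgN; exact: cvg_id.
exact: continuous_powR_max0.
Qed.

End SignedPower.

Section LpDuality.
Variables (R : realType) (p s : R).
Hypotheses (p1 : 1 < p) (s0 : 0 < s).
Implicit Types (u v w x y : R * R).

Let ple1 : 1 <= p. Proof. exact: ltW. Qed.
Let p0 : 0 < p. Proof. exact: lt_trans p1. Qed.
Let r0 : 0 < p - 1. Proof. by rewrite subr_gt0. Qed.
Let N := lp_norm ple1 s0.
Local Notation sp := (signed_powR (p - 1)).

Definition lp_gradient u : R * R := (sp u.1, sp u.2).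

Lemma lp_gradient_diag u : dot (lp_gradient u) u = lp_sum p u.
Proof. by rewrite /dot /= !signed_powRM// subrK. Qed.

Lemma signed_powR_young a b : `|sp a * b| <= `|a| `^ p * (1 - p^-1) + `|b| `^ p / p.
Proof.
have pn0 : p != 0 by rewrite gt_eqF.
have q0 : 0 < p / (p - 1) by rewrite divr_gt0.
have pq : p^-1 + (p / (p - 1))^-1 = 1.
  by field; rewrite pn0 gt_eqF.
rewrite normrM normr_signed_powR// mulrC.
apply: le_trans (conjugate_powR (normr_ge0 b) (powR_ge0 _ _) p0 q0 pq) _.
rewrite -powRrM mulrCA mulfV ?gt_eqF// mulr1 addrC -{2}pq [p^-1 + _]addrC addrK.
exact: lexx.
Qed.

Lemma lp_gradient_young u x :
  `|dot (lp_gradient u) x| <= lp_sum p u * (1 - p^-1) + lp_sum p x / p.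
Proof.
rewrite /dot /=; apply: le_trans (ler_normD _ _) _.
have := signed_powR_young u.1 x.1; have := signed_powR_young u.2 x.2.
by rewrite /lp_sum; lra.
Qed.

Lemma lp_norm_le1 x : (N x <= 1) = (lp_sum p x <= s `^ p).
Proof. by rewrite -[N x]/(lp_gauge p s x) lp_gauge_le// mulr1. Qed.

Lemma lp_norm1 x : N x = 1 -> lp_sum p x = s `^ p.
Proof. by move=> Nx; rewrite -(lp_gaugeX ple1 s0) -[lp_gauge _ _ _]/(N x) Nx mulr1. Qed.

Let S0 : 0 < s `^ p. Proof. by rewrite powR_gt0. Qed.

Definition lp_dual u := (s `^ p)^-1 *: lp_gradient u.

Lemma dot_lp_dual u x : dot (lp_dual u) x = (s `^ p)^-1 * dot (lp_gradient u) x.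
Proof. by rewrite /dot /= /GRing.scale /=; ring. Qed.

Lemma lp_dual_diag u : N u = 1 -> dot (lp_dual u) u = 1.
Proof.
by move=> Nu; rewrite dot_lp_dual lp_gradient_diag lp_norm1// mulVf// gt_eqF.
Qed.

Lemma lp_dual_le u x : N u = 1 -> `|dot (lp_dual u) x| <= N x.
Proof.
move=> Nu; have ball y : N y <= 1 -> `|dot (lp_dual u) y| <= 1.
  rewrite lp_norm_le1 => Ny.
  rewrite dot_lp_dual normrM ger0_norm ?invr_ge0 ?(ltW S0)// ler_pdivrMl// mulr1.
  apply: le_trans (lp_gradient_young _ _) _; rewrite lp_norm1//.
  by rewrite mulrBr mulr1 -lerBrDl opprB addrCA subrr addr0 ler_pM2r ?invr_gt0.
have [->|x0] := eqVneq x 0; first by rewrite pnorm0 /dot /= !mulr0 addr0 normr0.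
have Nx : 0 < N x by exact: pnorm_gt0.
rewrite -[X in dot _ X]scale1r -(mulfV (lt0r_neq0 Nx)) -scalerA dotZr normrM.
rewrite gtr0_norm// ler_piMr ?(ltW Nx)//; apply: ball.
by rewrite pnormZ ger0_norm ?invr_ge0 ?(ltW Nx)// mulVf ?lexx// gt_eqF.
Qed.

(** Let g be the gradient form at u + t d, applied to d. By Young's inequality
the gradient form at u + t d is no larger at u than at u + t d, so t and g t
do not have opposite signs. As g is continuous, it vanishes at 0. *)
Lemma lp_dual_smooth u d : N u = 1 -> (forall t, 1 <= N (u + t *: d)) ->
  dot (lp_dual u) d = 0.
Proof.
move=> Nu Nd; pose g t := dot (lp_gradient (u + t *: d)) d.
have g_sign t : 0 <= t * g t.
  have diag := lp_gradient_diag (u + t *: d).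
  rewrite dotDr dotZr -/(g t) in diag.
  have := lp_gradient_young (u + t *: d) u; rewrite (lp_norm1 Nu) => yg.
  have S1 : s `^ p <= lp_sum p (u + t *: d).
    rewrite leNgt; apply/negP => lt; have := Nd t.
    have [/eqP e|ne] := eqVneq (N (u + t *: d)) 1.
      by move: e => /eqP/lp_norm1 e; rewrite e ltxx in lt.
    by rewrite leNgt lt_neqAle ne lp_norm_le1 ltW.
  have {yg} := le_trans (ler_norm _) yg.
  have : s `^ p / p <= lp_sum p (u + t *: d) / p by rewrite ler_pM2r ?invr_gt0.
  by rewrite mulrBr mulr1; lra.
have gc : continuous g.
  move=> t; have lc : continuous (fun t : R => u + t *: d).
    move=> t'; apply: cvgD; first exact: cvg_cst.
    by apply: cvgZr_tmp; exact: cvg_id.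
  have c1 : continuous (fun t : R => (u + t *: d).1).
    by move=> t'; apply: (continuous_comp (lc t')); exact: cvg_fst.
  have c2 : continuous (fun t : R => (u + t *: d).2).
    by move=> t'; apply: (continuous_comp (lc t')); exact: cvg_snd.
  apply: cvgD; (apply: cvgM; last exact: cvg_cst).
    by apply: (continuous_comp (c1 t)); exact: continuous_signed_powR.
  by apply: (continuous_comp (c2 t)); exact: continuous_signed_powR.
rewrite dot_lp_dual (_ : dot _ d = g 0); last by rewrite /g scale0r addr0.
apply/eqP; rewrite mulf_eq0 invr_eq0 (gt_eqF S0) /=.
have half (e : R) : 0 < e -> ball 0 e (e / 2) /\ ball 0 e (- (e / 2)).
  by move=> e0; rewrite /ball /= !sub0r !normrN gtr0_norm ?divr_gt0//; split; lra.
have [gneg|gpos|//] := ltgtP (g 0) 0.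
  have near0 : \forall t \near (0 : R), g t < 0 by exact: cvgr_lt (gc 0) _ gneg.
  have /nbhs_ballP[e /= e0 /(_ (e / 2))] := near0.
  move=> /(_ (half e e0).1) glt; have := g_sign (e / 2).
  by rewrite leNgt pmulr_rlt0 ?divr_gt0// glt.
have near0 : \forall t \near (0 : R), 0 < g t by exact: cvgr_gt (gc 0) _ gpos.
have /nbhs_ballP[e /= e0 /(_ (- (e / 2)))] := near0.
move=> /(_ (half e e0).2) glt; have := g_sign (- (e / 2)).
by rewrite leNgt nmulr_rlt0 ?glt// oppr_lt0 divr_gt0.
Qed.

Lemma lp_dual_inj u v : N u = 1 -> N v = 1 -> lp_dual u = lp_dual v -> u = v.
Proof.
move=> _ _ /(scalerI (invr_neq0 (lt0r_neq0 S0)))[e1 e2].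
by apply: injective_projections; apply: (signed_powR_inj r0).
Qed.

Definition lp_duality : duality_map N :=
  DualityMap lp_dual_diag lp_dual_le lp_dual_smooth lp_dual_inj.

End LpDuality.

(** * Minimal equilateral pairs and monotonicity of the area *)

Section Minimum.
Variables (R : realType) (N : planar_norm R).
Implicit Types (u v w x y : R * R).

(** Parallel unit vectors are equal or opposite, so they are at distance 0 or
2. *)
Lemma equilateral_cross u w : equilateral N u w -> cross u w != 0.
Proof.
move=> [Nu Nw Nwu]; apply/eqP => uw.
have u0 : u != 0.
  by apply/eqP => u0; move: Nu; rewrite u0 pnorm0 => /eqP; rewrite eq_sym oner_eq0.
have [k wk] : exists k, w = k *: u.
  pose n := u.1 ^+ 2 + u.2 ^+ 2.
  have n0 : n != 0.
    apply: contra u0; rewrite paddr_eq0 ?sqr_ge0// !sqrf_eq0 => /andP[/eqP e1 /eqP e2].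
    by apply/eqP/injective_projections.
  exists ((u.1 * w.1 + u.2 * w.2) / n).
  move: uw; rewrite /cross => /eqP; rewrite subr_eq0 => /eqP uw.
  apply: injective_projections; rewrite /= /GRing.scale /= mulrAC; apply: (mulIf n0);
    rewrite divfK// /n.
    have := congr1 ( *%R u.2) uw; lra.
  have := congr1 ( *%R u.1) uw; lra.
have k1 : `|k| = 1 by rewrite -Nw wk pnormZ Nu mulr1.
move: Nwu; rewrite wk -{2}(scale1r u) -scalerBl pnormZ Nu mulr1.
by move: k1; case: (ger0P k); case: (ger0P (k - 1)); lra.
Qed.

(** The equilateral pairs with nonnegative cross product form a compact set. *)
Lemma min_equilateral : exists u w, [/\ equilateral N u w, 0 < cross u w &
  forall u' w', equilateral N u' w' -> 0 < cross u' w' -> cross u w <= cross u' w'].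
Proof.
pose f (q : (R * R) * (R * R)) := cross q.1 q.2.
have cf1 : continuous (fun q : (R * R) * (R * R) => q.1) by move=> q; exact: cvg_fst.
have cf2 : continuous (fun q : (R * R) * (R * R) => q.2) by move=> q; exact: cvg_snd.
have cfst : continuous (fun v : R * R => v.1) by move=> v; exact: cvg_fst.
have csnd : continuous (fun v : R * R => v.2) by move=> v; exact: cvg_snd.
have cN := @pnorm_continuous _ N.
have fc : continuous f.
  move=> q; apply: cvgB; apply: cvgM.
  - by apply: (continuous_comp (cf1 q)); exact: cfst.
  - by apply: (continuous_comp (cf2 q)); exact: csnd.
  - by apply: (continuous_comp (cf1 q)); exact: csnd.
  - by apply: (continuous_comp (cf2 q)); exact: cfst.
pose S := [set q | N q.1 = 1] `&` [set q | N q.2 = 1] `&`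
  [set q | N (q.2 - q.1) = 1] `&` [set q | 0 <= f q].
have cl (g : (R * R) * (R * R) -> R) (D : set R) : continuous g -> closed D ->
    closed (g @^-1` D).
  by move=> cg cD; apply: preimage_closed => // q _; exact: cg.
have Scl : closed S.
  apply: closedI; [apply: closedI; [apply: closedI|]|].
  - apply: (cl (fun q => N q.1) [set y | y = 1]); last exact: closed_eq.
    by move=> q; apply: (continuous_comp (cf1 q)); exact: cN.
  - apply: (cl (fun q => N q.2) [set y | y = 1]); last exact: closed_eq.
    by move=> q; apply: (continuous_comp (cf2 q)); exact: cN.
  - apply: (cl (fun q => N (q.2 - q.1)) [set y | y = 1]); last exact: closed_eq.
    have cd : continuous (fun q : (R * R) * (R * R) => q.2 - q.1).
      by move=> q; apply: cvgB; [exact: cf2|exact: cf1].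
    by move=> q; apply: (continuous_comp (cd q)); exact: cN.
  - by apply: (cl f [set y | 0 <= y]); [exact: fc|exact: closed_ge].
have [c c0 cNv] := pnorm_coord N.
pose I : set R := `[- c, c]%classic.
have cI : compact I by exact: segment_compact.
have Scpt : compact S.
  apply: (subclosed_compact Scl (compact_setX (compact_setX cI cI) (compact_setX cI cI))).
  have inI v : N v = 1 -> (I `*` I) v.
    move=> Nv; have [] := cNv v; rewrite Nv mulr1 => h1 h2.
    by split; rewrite /I /= in_itv /= -ler_norml.
  by move=> q [[[q1 q2] _] _]; split; apply: inI.
have SP q : S q <-> equilateral N q.1 q.2 /\ 0 <= f q.
  by split=> [[[[? ?] ?] ?]|[[? ? ?] ?]].
have S0 : S !=set0.
  pose e : R * R := (1, 0).
  have e0 : e != 0 by apply/eqP => -[/eqP]; rewrite oner_eq0.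
  have Ne0 := pnorm_gt0 N e0.
  have [|x ex xpos] := @equilateral_exists _ N ((N e)^-1 *: e).
    by rewrite pnormZ ger0_norm ?invr_ge0 ?ltW// mulVf// gt_eqF.
  by exists ((N e)^-1 *: e, x); apply/SP; split=> //; exact: ltW.
have [q /[!inE] /SP[eq fq] qmin] :=
  compact_EVT_min S0 Scpt (continuous_subspaceT fc).
exists q.1, q.2; split=> //.
  by rewrite lt_neqAle eq_sym equilateral_cross.
move=> u w euw uw0; apply: (qmin (u, w)); rewrite inE; apply/SP; split=> //.
exact: ltW.
Qed.

End Minimum.

Section AreaMonotone.
Variable R : realType.
Local Notation area := (lebesgue_measure \x lebesgue_measure)%E.

(** The integral of a nonnegative function is a supremum over simple functions
below it, and the length of a set is an outer measure: both are monotone on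
arbitrary functions and sets. So the area of any hexagon that contains the ball
can be bounded below without describing its region. *)
Lemma area_subset (X Y : set (measurableTypeR R * measurableTypeR R)) :
  X `<=` Y -> (area X <= area Y)%E.
Proof.
move=> XY; rewrite /product_measure1.
rewrite !ge0_integralTE//; apply: le_ereal_sup => _ [g gX <-]; exists g => // x.
apply: le_trans (gX x) _; apply: (@le_mu_ext _ _ R (wlength idfun)) => y.
by rewrite /xsection /= !inE; exact: XY.
Qed.
End AreaMonotone.

(** * The square *)

Section Taxicab.
Variables (R : realType).
Implicit Types (u v w x y : R * R).

(** Each of the three vectors has a coordinate equal to s or - s. Every choice of
these coordinates either contradicts the bounds on the others, or makes the
cross product equal to the square of s up to sign. *)
Lemma sup_equilateral (s X1 Y1 X2 Y2 : R) : 0 < s ->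
    Num.max `|X1| `|Y1| = s -> Num.max `|X2| `|Y2| = s ->
    Num.max `|X2 - X1| `|Y2 - Y1| = s ->
  s ^+ 2 <= `|X1 * Y2 - Y1 * X2|.
Proof.
move=> s0; have maxE a b : Num.max `|a| `|b| = s ->
    [/\ - s <= a <= s, - s <= b <= s & [\/ a = s, a = - s, b = s | b = - s]].
  have eqn (t : R) : `|t| = s -> t = s \/ t = - s.
    by case: (ger0P t) => _ <-; [left|right; rewrite opprK].
  move=> ms; rewrite -!ler_norml -{1 2}ms !le_max !lexx orbT; split=> //.
  move: ms; case: leP => _ /eqn[->|->];
    [exact: Or43|exact: Or44|exact: Or41|exact: Or42].
move=> /maxE[b1 b2 e1] /maxE[b3 b4 e2] /maxE[b5 b6 e3]; rewrite ler_normr expr2.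
by move: b1 b2 b3 b4 b5 b6 e3; case: e1 => ->; case: e2 => -> /andP[? ?] /andP[? ?]
  /andP[? ?] /andP[? ?] /andP[? ?] /andP[? ?]; case=> e;
  (* Products of variables are atoms of linear arithmetic, so e is also needed
     multiplied by each variable. *)
  have es := congr1 ( *%R s) e; have eX1 := congr1 ( *%R X1) e;
  have eY1 := congr1 ( *%R Y1) e; have eX2 := congr1 ( *%R X2) e;
  have eY2 := congr1 ( *%R Y2) e;
  first [exfalso; lra | apply/orP; left; lra | apply/orP; right; lra].
Qed.

End Taxicab.

Section TaxicabNorm.
Variables (R : realType) (s : R).
Implicit Types (u v w : R * R).
Hypothesis s0 : 0 < s.
Let N := lp_norm (lexx 1) s0.

Lemma taxicabE (x : R * R) : N x = (`|x.1| + `|x.2|) / s.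
Proof.
by rewrite /N /= /lp_gauge /lp_sum invr1 !powRr1 ?addr_ge0.
Qed.

(** The change of variables (x + y, x - y) turns the sum of absolute values into
their maximum, and multiplies cross products by -2. *)
Lemma taxicab_equilateral u w : equilateral N u w -> s ^+ 2 / 2 <= `|cross u w|.
Proof.
have maxE (x y : R) : `|x| + `|y| = Num.max `|x + y| `|x - y| :> R.
  by case: leP; case: (ger0P x) => ?; case: (ger0P y) => ?;
    case: (ger0P (x + y)) => ?; case: (ger0P (x - y)) => ? ?; lra.
have NE (x : R * R) : N x = 1 -> Num.max `|x.1 + x.2| `|x.1 - x.2| = s.
  by rewrite taxicabE -maxE => /(canRL (divfK (lt0r_neq0 s0))); rewrite mul1r.
move=> [/NE eu /NE ew /NE ewu].
have := @sup_equilateral R s (u.1 + u.2) (u.1 - u.2) (w.1 + w.2) (w.1 - w.2) s0 eu ew.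
rewrite (_ : w.1 + w.2 - _ = (w - u).1 + (w - u).2); last by rewrite /=; ring.
rewrite (_ : w.1 - w.2 - _ = (w - u).1 - (w - u).2); last by rewrite /=; ring.
move=> /(_ ewu); rewrite (_ : _ - _ = - 2 * cross u w); last by rewrite /cross; ring.
by rewrite normrM normrN (ger0_norm (ler0n R 2)); lra.
Qed.

(** The unit ball is itself a hexagon of the class, with two of its vertices at
midpoints of sides of the square and with the midpoints of its own sides as
contact points. *)
Lemma taxicab_hexagon : [/\ hexagon_areas (unit_ball N) (2 * s ^+ 2),
  4 * critical_det (unit_ball N) <= 2 * s ^+ 2 &
  (lebesgue_measure \x lebesgue_measure)%E (unit_ball N) = (2 * s ^+ 2)%:E].
Proof.
pose A : R * R := (s, 0); pose B : R * R := (s / 2, s / 2); pose C : R * R := (0, s).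
have s2 : 0 < s ^+ 2 by rewrite exprn_gt0.
have AB : cross A B = s ^+ 2 / 2 by rewrite /cross /=; field.
have BC : cross B C = s ^+ 2 / 2 by rewrite /cross /=; field.
have AC : cross A C = s ^+ 2 by rewrite /cross /=; field.
have tot : cross A B + cross B C + cross A C = 2 * s ^+ 2.
  by rewrite AB BC AC; field.
have pABC : proper_hex A B C by split; rewrite ?AB ?BC ?AC; lra.
have regE : hexagon_region (hex A B C) = unit_ball N.
  rewrite hexagon_region_hex//; apply/seteqP.
  have e1 (x : R * R) : cross x (B - A) = s / 2 * (x.1 + x.2) by rewrite /cross /=; field.
  have e2 (x : R * R) : cross x (C - B) = s / 2 * (x.1 + x.2) by rewrite /cross /=; field.
  have e3 (x : R * R) : cross x (A + C) = s * (x.1 - x.2) by rewrite /cross /=; field.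
  have s20 : 0 < s / 2 by rewrite divr_gt0.
  have half : s ^+ 2 / 2 = s / 2 * s by field.
  have ballE (x : R * R) : unit_ball N x <-> `|x.1| + `|x.2| <= s.
    by rewrite -[unit_ball N x]/(is_true (N x <= 1)) taxicabE ler_pdivrMr// mul1r.
  have stripE (x : R * R) : hex_strips A B C x <->
      `|x.1 + x.2| <= s /\ `|x.1 - x.2| <= s.
    rewrite /hex_strips /= AB BC AC e1 e2 e3 half expr2.
    rewrite !(normrM (s / 2)) (gtr0_norm s20) !(normrM s) (gtr0_norm s0) !ler_pM2l//.
    by split=> [[]|[]].
  split=> x; rewrite -[hex_strips A B C x]/(hex_strips A B C x).
    move=> /stripE[]; rewrite !ler_norml => /andP[? ?] /andP[? ?]; apply/ballE.
    by case: (ger0P x.1) => ?; case: (ger0P x.2) => ?; lra.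
  move=> /ballE le; apply/stripE.
  by split; apply: le_trans le; [exact: ler_normD|exact: ler_normB].
rewrite -tot; split; last 2 first.
- by apply: critical_det_le_hex pABC _; rewrite regE.
- rewrite -regE hexagon_region_hex// area_hex_strips//; first by rewrite AB BC AC; lra.
  by rewrite AB BC AC; lra.
have mid (P Q : R * R) i : hex A B C i = P -> hex A B C (i + 1) = Q ->
    side (hex A B C) i (2^-1 *: (P + Q)).
  move=> iP iQ; apply: (@side_affine _ _ _ (2^-1)); first by apply/andP; split; lra.
  by rewrite iP iQ; apply: injective_projections; rewrite /= /GRing.scale /=; field.
apply: (@hex_areas_mem _ _ _ _ _ (2^-1 *: (A + B)) (2^-1 *: (B + C))
  (2^-1 *: (C - A))) => //.
- by rewrite AB BC AC; lra.
- by rewrite AB BC AC; lra.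
- by rewrite regE.
- apply: hex_inj; split; rewrite /cross /= /GRing.scale /=; nra.
- by rewrite taxicabE /= /GRing.scale /= !gtr0_norm; [by field; rewrite gt_eqF| |]; move: s0; lra.
- by rewrite taxicabE /= /GRing.scale /= !gtr0_norm; [by field; rewrite gt_eqF| |]; move: s0; lra.
- rewrite taxicabE /= /GRing.scale /=.
  by rewrite ltr0_norm ?gtr0_norm; [by field; rewrite gt_eqF| |]; move: s0; lra.
- by apply: mid; rewrite ?inordS hexE.
- by apply: mid; rewrite ?inordS hexE.
- by apply: mid; rewrite ?inordS hexE.
Qed.

End TaxicabNorm.

(** * Minimal hexagons *)

Section Extremal.
Variables (R : realType) (N : planar_norm R).

Lemma admissible_lattice_exists : exists L d,
  lattice_with_det L d /\ admissible (unit_ball N) L.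
Proof.
have [c c0 cN] := pnorm_coord N.
exists [set x | exists a b : int, x = (c, 0) *~ a + (0, c) *~ b], (`|cross (c, 0) (0, c)|).
split.
  by exists (c, 0), (0, c); split=> //; rewrite /cross /= mulr0 subr0 mulf_neq0// gt_eqF.
move=> _ [a [b ->]] /interior_unit_ball.
have -> : (c, 0) *~ a + (0, c) *~ b = (c * a%:~R, c * b%:~R).
  have E (v : R * R) (n : int) : v *~ n = n%:~R *: v by rewrite scaler_int.
  rewrite !E.
  by apply: injective_projections; rewrite /= /GRing.scale /=; ring.
move=> Nlt; have := cN (c * a%:~R, c * b%:~R); rewrite /= !normrM gtr0_norm//.
rewrite !ler_pM2l// -!intr_norm => -[ha hb].
have small (n : int) : `|n|%:~R <= N (c * a%:~R, c * b%:~R) -> n = 0.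
  move=> /le_lt_trans/(_ Nlt); rewrite ltrz1.
  by case: n => [[|n]|n].
by rewrite (small _ ha) (small _ hb) !mulr0z !mulr0.
Qed.

(** If s is at most 4 d for every admissible determinant d, it is at most four
times their infimum, which in turn is a lower bound of all the areas, s
included. So s is the least area, and equality holds. *)
Lemma hexagon_areas_min (s : R) : hexagon_areas (unit_ball N) s ->
    (forall L d, lattice_with_det L d -> admissible (unit_ball N) L -> s <= 4 * d) ->
    (forall t, hexagon_areas (unit_ball N) t -> 4 * critical_det (unit_ball N) <= t) ->
  hexagon_areas (unit_ball N) (Shma (unit_ball N)) /\
  Shma (unit_ball N) = 4 * critical_det (unit_ball N).
Proof.
move=> areas_s s_le le_areas.
have sE : s = 4 * critical_det (unit_ball N).
  apply/eqP; rewrite eq_le le_areas// andbT -ler_pdivrMl//.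
  apply: lb_le_inf.
    by have [L [d [Ld admL]]] := admissible_lattice_exists; exists d, L.
  by move=> d [L Ld admL]; rewrite ler_pdivrMl//; exact: s_le Ld admL.
suff -> : Shma (unit_ball N) = s by split.
apply/eqP; rewrite eq_le; apply/andP; split.
  by apply: ge_inf => //; exists s => t /le_areas; rewrite -sE.
by apply: lb_le_inf; [exists s|move=> t /le_areas; rewrite -sE].
Qed.

(** The hexagon of an equilateral pair with least cross product has area at most
four times the determinant of any admissible lattice. *)
Lemma shma_dual (J : duality_map N) :
  hexagon_areas (unit_ball N) (Shma (unit_ball N)) /\
  Shma (unit_ball N) = 4 * critical_det (unit_ball N).
Proof.
have [u [w [euw uw uw_min]]] := min_equilateral N.
have [s areas_s s_le] := dual_hexagon J euw uw.
apply: (hexagon_areas_min areas_s) => [L d Ld admL|]; last first.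
  exact: circumscribed_area_ge.
have [u' [w' [euw' /andP[uw' le_d]]]] := lattice_reduction Ld admL.
apply: le_trans s_le _; rewrite ler_pM2l//.
by apply: le_trans le_d; exact: uw_min.
Qed.

End Extremal.

(** A circumscribed hexagon need not be symmetric here, but its area is at least
that of the ball, which is four times the critical determinant. *)
Lemma shma_taxicab (R : realType) (s : R) (s0 : 0 < s) (N := lp_norm (lexx 1) s0) :
  hexagon_areas (unit_ball N) (Shma (unit_ball N)) /\
  Shma (unit_ball N) = 4 * critical_det (unit_ball N).
Proof.
have [areas_s det_le areaN] := taxicab_hexagon s0.
apply: (hexagon_areas_min areas_s) => [L d Ld admL|t].
  have [u [w [euw /andP[uw le_d]]]] := lattice_reduction Ld admL.
  by have := taxicab_equilateral euw; rewrite gtr0_norm//; lra.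
move=> [h [_ [Kh _] _ areah]].
apply: le_trans det_le _; rewrite -lee_fin -areaN -areah.
exact: area_subset.
Qed.

(* The first conjunct says that the minimal area is attained. *)
Theorem theorem4 (R : realType) (p : R) (m : nat) (hp : 1 <= p)
    (hm : (1 <= m)%N) :
  hexagon_areas (dilate (2 ^+ m) (lp_disc p))
    (Shma (dilate (2 ^+ m) (lp_disc p))) /\
  Shma (dilate (2 ^+ m) (lp_disc p)) =
    4 * critical_det (dilate (2 ^+ m) (lp_disc p)).
Proof.
have s0 : 0 < 2 ^+ m :> R by rewrite exprn_gt0.
rewrite (dilate_lp_disc hp s0).
have [p1|] := eqVneq p 1; last first.
  move=> p1; have hp1 : 1 < p by rewrite lt_neqAle eq_sym p1.
  rewrite (bool_irrelevance hp (ltW hp1)); exact: shma_dual (lp_duality hp1 s0).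
by subst p; rewrite (bool_irrelevance hp (lexx 1)); exact: shma_taxicab.
Qed.
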